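(* Let $X \subset \mathbb{C}^{N+1}$ be the affine cone over a projective variety and let $Y \subset X$ be the affine cone over a projective subvariety of $\mathbb{P}(X)$. Let $I_X$ be the closure of $N^*_{X_{smooth}/\mathbb{C}^{N+1}}$ in $\mathbb{C}^{N+1} \times (\mathbb{C}^{N+1})^*$, with canonical projections $p : I_X \to (\mathbb{C}^{N+1})^*$ and $q : I_X \to \mathbb{C}^{N+1}$, and let $X^* = p(I_X)$. Then for generic $y \in Y$ we have $$\big\langle \overline{T_{p(q^{-1}(y)),\, X^*_{smooth}}} \big\rangle \subset T_{Y,y}^{\perp}.$$
   Context: All varieties are over $\mathbb{C}$. For a variety $V$, $V_{smooth}$ is its smooth locus. For an affine cone $Z$ in a vector space, $\mathbb{P}(Z)$ denotes the corresponding closed projective scheme. $N^*_{X_{smooth}/\mathbb{C}^{N+1}}$ denotes the total space of the conormal bundle of $X_{smooth}$ in $\mathbb{C}^{N+1}$, i.e. the set of pairs $(x,\xi)$ with $x \in X_{smooth}$ and $\xi \in (\mathbb{C}^{N+1})^*$ vanishing on $T_{X,x}$. The variety $X^* = p(I_X)\subset(\mathbb{C}^{N+1})^*$ is the affine cone over the projective dual of $\mathbb{P}(X)$. For $y \in Y$, $q^{-1}(y)$ is the scheme-theoretic fibre, contained in $\{y\}\times(\mathbb{C}^{N+1})^*$, and $p(q^{-1}(y))$ is this (possibly non-reduced) scheme viewed as a closed subscheme of $X^* \subset (\mathbb{C}^{N+1})^*$. For a closed subscheme $Z$ of a variety $W$ contained in a vector space $V$, $\big\langle \overline{T_{Z,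 W_{smooth}}} \big\rangle$ denotes the linear span in $V$ of the Zariski closure of the union of the (Zariski) tangent spaces to $Z$ at those points of $Z$ which are smooth points of $W$, these tangent spaces being regarded as linear subspaces of $V$. Here it is applied with $Z = p(q^{-1}(y))$, $W = X^*$ and $V=(\mathbb{C}^{N+1})^*$. $T_{Y,y}^{\perp} \subset (\mathbb{C}^{N+1})^*$ is the annihilator of $T_{Y,y} \subset \mathbb{C}^{N+1}$. ''Generic $y\in Y$'' means all $y$ in some non-empty (dense) Zariski open subset of $Y$. *)

(* Defs.v *)
From HB Require Import structures.
From mathcomp Require Import all_boot all_order all_algebra.
From mathcomp Require Import complex.
From mathcomp Require Import boolp classical_sets reals.
From mathcomp Require Import mpoly.

Set Implicit Arguments.
Unset Strict Implicit.
Unset Printing Implicit Defensive.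

Import GRing.Theory.
Local Open Scope ring_scope.
Local Open Scope classical_set_scope.

(** Classical affine and projective algebraic geometry over an algebraically
    closed field.  Points of affine n-space are row vectors; the dual space is
    also ['rV[F]_n], in dual coordinates, with the pairing [pairing] below. *)

(** ** Affine algebraic sets *)

Definition zero_locus (F : closedFieldType) (n : nat)
    (S : set {mpoly F[n]}) : set 'rV[F]_n :=
  [set x : 'rV[F]_n | forall f, S f -> f.@[x ord0] = 0].

Definition vanishing_ideal (F : closedFieldType) (n : nat)
    (A : set 'rV[F]_n) : set {mpoly F[n]} :=
  [set f : {mpoly F[n]} | forall x : 'rV[F]_n, A x -> f.@[x ord0] = 0].

Definition zariski_closed (F : closedFieldType) (n : nat)
    (A : set 'rV[F]_n) : Prop :=
  exists S : set {mpoly F[n]}, A = zero_locus S.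

Definition zariski_open (F : closedFieldType) (n : nat)
    (A : set 'rV[F]_n) : Prop :=
  zariski_closed (~` A).

Definition zariski_closure (F : closedFieldType) (n : nat)
    (A : set 'rV[F]_n) : set 'rV[F]_n :=
  [set x : 'rV[F]_n | forall B, zariski_closed B -> A `<=` B -> B x].

(** Irreducible closed sets, for the topology whose closed sets are [closed]. *)
Definition irreducible_closed (T : Type) (closed : set T -> Prop) (A : set T)
    : Prop :=
  [/\ closed A, A !=set0 &
      forall B C, closed B -> closed C -> A `<=` B `|` C ->
        A `<=` B \/ A `<=` C].

(** Since the varieties to which this is applied are irreducible, a non-empty
    relatively open subset is automatically dense. *)
Definition generically (F : closedFieldType) (n : nat) (A : set 'rV[F]_n)
    (Prp : 'rV[F]_n -> Prop) : Prop :=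
  exists U : set 'rV[F]_n,
    [/\ zariski_open U, A `&` U !=set0 & forall y, A y -> U y -> Prp y].

(** ** Projective varieties and their affine cones *)

Definition proj_space (F : closedFieldType) (N : nat) : Type :=
  {L : {vspace 'rV[F]_N.+1} | \dim L == 1%N}.

Definition proj_closed (F : closedFieldType) (N : nat)
    (P : set (proj_space F N)) : Prop :=
  exists2 S : set {mpoly F[N.+1]},
    (forall f, S f -> exists d : nat, f \is d.-homog) &
    P = [set L : proj_space F N | forall f, S f ->
                   forall x : 'rV[F]_N.+1, x \in sval L -> f.@[x ord0] = 0].

Definition proj_variety (F : closedFieldType) (N : nat)
    (P : set (proj_space F N)) : Prop :=
  irreducible_closed (@proj_closed F N) P.

Definition affine_cone (F : closedFieldType) (N : nat)
    (P : set (proj_space F N)) : set 'rV[F]_N.+1 :=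
  [set x : 'rV[F]_N.+1 |
    x = 0 \/ exists2 L : proj_space F N, P L & x \in sval L].

(** ** Closed subschemes of affine space, given by their ideals *)

Definition is_ideal (F : closedFieldType) (n : nat) (J : set {mpoly F[n]})
    : Prop :=
  [/\ J 0, forall f g, J f -> J g -> J (f + g) &
      forall f g, J g -> J (f * g)].

Definition ideal_generated (F : closedFieldType) (n : nat)
    (S : set {mpoly F[n]}) : set {mpoly F[n]} :=
  [set f : {mpoly F[n]} | forall J, is_ideal J -> S `<=` J -> J f].

(** Zariski tangent space at [x] of the closed subscheme with ideal [J], as a
    linear subspace of the ambient vector space; meant for [zero_locus J x]. *)
Definition tangent_space (F : closedFieldType) (n : nat)
    (J : set {mpoly F[n]}) (x : 'rV[F]_n) : set 'rV[F]_n :=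
  [set v : 'rV[F]_n |
    forall f, J f -> \sum_(i < n) (f^`M(i)).@[x ord0] * v ord0 i = 0].

Definition variety_tangent_space (F : closedFieldType) (n : nat)
    (A : set 'rV[F]_n) (x : 'rV[F]_n) : set 'rV[F]_n :=
  tangent_space (vanishing_ideal A) x.

(** Strict chains of length [d] of irreducible closed subsets of [A] through
    [x]; for [A] closed, they correspond to chains of prime ideals of the local
    ring of [A] at [x]. *)
Definition has_chain_at (F : closedFieldType) (n : nat) (A : set 'rV[F]_n)
    (x : 'rV[F]_n) (d : nat) : Prop :=
  exists Z : nat -> set 'rV[F]_n,
    [/\ forall k, (k <= d)%N ->
          irreducible_closed (@zariski_closed F n) (Z k),
        forall k, (k < d)%N -> Z k `<` Z k.+1,
        Z 0%N x & Z d `<=` A].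

(** Krull dimension of the local ring of [A] at [x]. *)
Definition has_local_dim (F : closedFieldType) (n : nat) (A : set 'rV[F]_n)
    (x : 'rV[F]_n) (d : nat) : Prop :=
  has_chain_at A x d /\ forall e, has_chain_at A x e -> (e <= d)%N.

(** Smoothness at [x] as regularity of the local ring: its Krull dimension
    equals the dimension of the Zariski tangent space. *)
Definition smooth_locus (F : closedFieldType) (n : nat) (A : set 'rV[F]_n)
    : set 'rV[F]_n :=
  [set x : 'rV[F]_n | A x /\ exists T : {vspace 'rV[F]_n},
      variety_tangent_space A x = [set v : 'rV[F]_n | v \in T] /\
      has_local_dim A x (\dim T)].

(** ** Duality *)

Definition pairing (F : closedFieldType) (n : nat) (xi x : 'rV[F]_n) : F :=
  \sum_(i < n) xi ord0 i * x ord0 i.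

Definition annihilator (F : closedFieldType) (n : nat) (T : set 'rV[F]_n)
    : set 'rV[F]_n :=
  [set xi : 'rV[F]_n | forall v : 'rV[F]_n, T v -> pairing xi v = 0].

(** A point [z] of the product of the space and its dual has components
    [lsubmx z] (in the space) and [rsubmx z] (in the dual). *)
Definition conormal_bundle (F : closedFieldType) (n : nat) (X : set 'rV[F]_n)
    : set 'rV[F]_(n + n) :=
  [set z : 'rV[F]_(n + n) | smooth_locus X (lsubmx z) /\
           annihilator (variety_tangent_space X (lsubmx z)) (rsubmx z)].

Definition conormal_variety (F : closedFieldType) (n : nat) (X : set 'rV[F]_n)
    : set 'rV[F]_(n + n) :=
  zariski_closure (conormal_bundle X).

Definition dual_variety (F : closedFieldType) (n : nat) (X : set 'rV[F]_n)
    : set 'rV[F]_n :=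
  [set rsubmx z | z in conormal_variety X].

(** Ideal of the scheme-theoretic fibre over [y] of the first projection
    restricted to the reduced closed subscheme [I] of the product. *)
Definition fibre_ideal (F : closedFieldType) (n : nat)
    (I : set 'rV[F]_(n + n)) (y : 'rV[F]_n) : set {mpoly F[n + n]} :=
  ideal_generated
    (vanishing_ideal I `|`
     [set 'X_(lshift n i) - (y ord0 i)%:MP | i in [set: 'I_n]]).

(** Ideal of the scheme-theoretic image under the second projection, i.e. the
    inverse image of [J] under the comorphism; it is the image as it stands
    for a closed subscheme contained in a slice [{y}] times the dual. *)
Definition snd_image_ideal (F : closedFieldType) (n : nat)
    (J : set {mpoly F[n + n]}) : set {mpoly F[n]} :=
  [set g : {mpoly F[n]} | J (g \mPo [tuple 'X_(rshift n i) | i < n])].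

Definition dual_fibre_ideal (F : closedFieldType) (n : nat)
    (X : set 'rV[F]_n) (y : 'rV[F]_n) : set {mpoly F[n]} :=
  snd_image_ideal (fibre_ideal (conormal_variety X) y).

Definition linear_span (F : closedFieldType) (n : nat) (S : set 'rV[F]_n)
    : set 'rV[F]_n :=
  [set v : 'rV[F]_n | forall U : {vspace 'rV[F]_n},
      (forall s : 'rV[F]_n, S s -> s \in U) -> v \in U].

(** Linear span of the closure of the union of the tangent spaces to the closed
    subscheme with ideal [J] at its points which are smooth points of [W]. *)
Definition tangent_span (F : closedFieldType) (n : nat)
    (J : set {mpoly F[n]}) (W : set 'rV[F]_n) : set 'rV[F]_n :=
  linear_span (zariski_closure
    (\bigcup_(x in zero_locus J `&` smooth_locus W) tangent_space J x)).

(* Main.v *)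
Require Import Defs.
From HB Require Import structures.
From mathcomp Require Import all_boot all_order all_algebra.
From mathcomp Require Import ring_quotient fraction generic_quotient.
From mathcomp Require Import complex.
From mathcomp Require Import boolp classical_sets reals.
From mathcomp Require Import mpoly.
From mathcomp Require Import ring.

(** The conormal variety [I] of [X] is Lagrangian, and the theorem is a
    consequence of this. Let [y] be a point of [Y] and [xi] a point of the fibre
    over [y]. A tangent vector [s] of the fibre at [xi] is a tangent vector
    [(0, s)] of [I] at [(y, xi)]. If a tangent vector [v] of [Y] at [y] lifts to
    a tangent vector [(v, u)] of [I], the symplectic product of the two is the
    pairing of [s] with [v], so it vanishes if [I] is isotropic at [(y, xi)].
    Two things remain: the lifting, for generic [y] and all [xi]
    ([generic_submersion]), and the isotropy of Zariski tangent spaces where [I]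
    may be singular, provided that [xi] is smooth on the dual variety
    ([conormal_isotropic]).

    Both rest on one fact ([generic_tangent_lift]): in characteristic zero
    derivations extend along field extensions, so a polynomial map is submersive
    from the generic point of a variety to the generic point of its image. A
    generic point is a point with coordinates in the function field. For the
    lifting, apply the fact to the part of [I] over [Y], and repeat on the closed
    subset where the lifted vectors degenerate; the Zariski topology is
    noetherian ([no_decreasing_sequence]).

    For the isotropy, apply the fact to the second projection of [I] and
    differentiate the relation [<x, xi> = 0]. This shows that at the generic point
    of [I] the point [x] annihilates the tangent space of the dual variety
    ([generic_incidence]). Let [h_1, ..., h_c] be equations of the dual variety
    whose differentials at a smooth point are a basis of its conormal space.
    Then [x] is in the span of the [dh_i] at the generic point
    ([generic_reflexivity]), and Cramer's rule makes this a system of polynomial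
    equations on [I]. Differentiated at [(y, xi)], these equations present the
    pairing of two tangent vectors as a value of a combination of the Hessians of
    the [h_i], and Hessians are symmetric.

    The generic point of [I] exists because [I] is irreducible
    ([conormal_prime]). This needs the smooth points of [X] to be dense as soon as
    there is one ([smooth_locus_dense]), and smoothness is defined by the lengths
    of chains of irreducible closed sets. A chain of length [e] gives [e]
    independent functions ([chain_independent]), which bound the dimension of
    tangent spaces from below ([jacobian_rank_bound]); conversely, [e] independent
    functions give chains of length [e] through a dense set of points
    ([chain_through]). *)

Set Implicit Arguments.
Unset Strict Implicit.
Unset Printing Implicit Defensive.

Import Order.TTheory GRing.Theory.
Local Open Scope ring_scope.
Local Open Scope classical_set_scope.

(** * Derivations of a subring extend to a larger field *)

Section Subring.
Variable K : fieldType.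
Implicit Types (L : set K) (a x y z : K) (p q r : {poly K}).

Definition is_subring L : Prop :=
  [/\ L 1, forall x y, L x -> L y -> L (x - y) &
      forall x y, L x -> L y -> L (x * y)].

Definition coefs_in L p : Prop := forall i, L p`_i.

Definition adjoin L a : set K := [set z | exists2 p, coefs_in L p & p.[a] = z].

Section Closure.
Variables (L : set K) (sL : is_subring L).

Lemma subring1 : L 1. Proof. by case: sL. Qed.
Lemma subringB x y : L x -> L y -> L (x - y). Proof. by case: sL => _ + _; apply. Qed.
Lemma subringM x y : L x -> L y -> L (x * y). Proof. by case: sL => _ _; apply. Qed.
Lemma subring0 : L 0. Proof. by rewrite -(subrr 1); apply: subringB; exact: subring1. Qed.
Lemma subringN x : L x -> L (- x).
Proof. by move=> Lx; rewrite -sub0r; apply: subringB => //; exact: subring0. Qed.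
Lemma subringD x y : L x -> L y -> L (x + y).
Proof. by move=> Lx Ly; rewrite -[y]opprK; apply: subringB => //; exact: subringN. Qed.
Lemma subringX x k : L x -> L (x ^+ k).
Proof.
move=> Lx; elim: k => [|k IH]; first by rewrite expr0; exact: subring1.
by rewrite exprS; exact: subringM.
Qed.
Lemma subring_sum (I : Type) (s : seq I) (P : pred I) (f : I -> K) :
  (forall i, P i -> L (f i)) -> L (\sum_(i <- s | P i) f i).
Proof. by move=> H; apply: big_ind => //; [exact: subring0|exact: subringD]. Qed.

Lemma coefs_inC x : L x -> coefs_in L x%:P.
Proof. by move=> Lx i; rewrite coefC; case: ifP => _ //; exact: subring0. Qed.
Lemma coefs_inX : coefs_in L 'X.
Proof. by move=> i; rewrite coefX; case: eqP => _; [exact: subring1|exact: subring0]. Qed.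
Lemma coefs_inB p q : coefs_in L p -> coefs_in L q -> coefs_in L (p - q).
Proof. by move=> Lp Lq i; rewrite coefB; exact: subringB. Qed.
Lemma coefs_inD p q : coefs_in L p -> coefs_in L q -> coefs_in L (p + q).
Proof. by move=> Lp Lq i; rewrite coefD; exact: subringD. Qed.
Lemma coefs_inM p q : coefs_in L p -> coefs_in L q -> coefs_in L (p * q).
Proof. by move=> Lp Lq i; rewrite coefM; apply: subring_sum => j _; exact: subringM. Qed.
Lemma coefs_inZ x p : L x -> coefs_in L p -> coefs_in L (x *: p).
Proof. by move=> Lx Lp i; rewrite coefZ; exact: subringM. Qed.
Lemma coefs_inXn k : coefs_in L 'X^k.
Proof. by move=> i; rewrite coefXn; case: eqP => _; [exact: subring1|exact: subring0]. Qed.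
Lemma coefs_in_deriv p : coefs_in L p -> coefs_in L p^`().
Proof.
move=> Lp i; rewrite coef_deriv -mulr_natr; apply: subringM => //.
by elim: (i.+1) => [|k IH]; [exact: subring0|rewrite mulrS; apply: subringD => //; exact: subring1].
Qed.

Lemma adjoin_sub a : L `<=` adjoin L a.
Proof. by move=> x Lx; exists x%:P; [exact: coefs_inC|rewrite hornerC]. Qed.
Lemma adjoin_mem a : adjoin L a a.
Proof. by exists 'X; [exact: coefs_inX|rewrite hornerX]. Qed.
Lemma adjoin_subring a : is_subring (adjoin L a).
Proof.
split; first by apply: adjoin_sub; exact: subring1.
- move=> _ _ [p Lp <-] [q Lq <-]; exists (p - q); first exact: coefs_inB.
  by rewrite hornerD hornerN.
- move=> _ _ [p Lp <-] [q Lq <-]; exists (p * q); first exact: coefs_inM.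
  by rewrite hornerM.
Qed.

(** [L] need not be a field: a power of the leading coefficient replaces the
    inverses of Euclidean division. *)
Lemma pseudo_division p r : coefs_in L p -> coefs_in L r -> r != 0 ->
  exists s q t, [/\ coefs_in L q, coefs_in L t, (size t < size r)%N &
                    lead_coef r ^+ s *: p = q * r + t].
Proof.
move=> + Lr r0; have [m] := ubnP (size p); elim: m p => // m IH p szp Lp.
have [ltpr|lerp] := ltnP (size p) (size r).
  exists 0%N, 0, p; split=> //; last by rewrite expr0 scale1r mul0r add0r.
  by move=> i; rewrite coef0; exact: subring0.
have p0 : p != 0 by rewrite -size_poly_gt0 (leq_trans _ lerp) // size_poly_gt0.
pose k := (size p - size r)%N.
pose p' := lead_coef r *: p - lead_coef p *: ('X^k * r).
have Lp' : coefs_in L p'.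
  apply: coefs_inB; apply: coefs_inZ => //; try exact: Lr; try exact: Lp.
  by apply: coefs_inM => //; exact: coefs_inXn.
have szp' : (size p' < size p)%N.
  have szm : (size p' <= size p)%N.
    rewrite (leq_trans (size_polyD _ _)) // size_polyN geq_max size_scale_leq /=.
    rewrite (leq_trans (size_scale_leq _ _)) //.
    by rewrite mulrC size_mulXn // /k subnK.
  rewrite ltn_neqAle szm andbT; apply/eqP => eqs.
  have : lead_coef p' = 0.
    rewrite /lead_coef eqs /p' coefB !coefZ coefXnM /k.
    have -> : ((size p).-1 < size p - size r)%N = false.
      by rewrite ltnNge; have := r0; rewrite -size_poly_gt0; case: (size p) lerp => [|u];
        case: (size r) => // w _ _; rewrite subSS /= leq_subr.
    have -> : ((size p).-1 - (size p - size r) = (size r).-1)%N.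
      have := p0; have := r0; rewrite -!size_poly_gt0.
      case: (size p) lerp => // u; case: (size r) => // w; rewrite ltnS subSS /= => le _ _.
      exact: subKn.
    by rewrite -!lead_coefE mulrC subrr.
  by move/eqP; rewrite lead_coef_eq0 -size_poly_eq0 eqs size_poly_eq0 (negPf p0).
have [s [q [t [Lq Lt szt E]]]] := IH p' (leq_trans szp' szp) Lp'.
exists s.+1, (q + (lead_coef r ^+ s * lead_coef p) *: 'X^k), t; split=> //.
  apply: coefs_inD => //; apply: coefs_inZ; last exact: coefs_inXn.
  by apply: subringM; [apply: subringX; exact: Lr|exact: Lp].
have -> : lead_coef r ^+ s.+1 *: p
     = lead_coef r ^+ s *: p' + (lead_coef r ^+ s * lead_coef p) *: ('X^k * r).
  by rewrite /p' scalerBr !scalerA exprSr subrK.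
by rewrite E mulrDl -scalerAl addrAC.
Qed.

Lemma min_annihilator a : (exists p, [/\ coefs_in L p, p != 0 & p.[a] = 0]) ->
  exists P, [/\ coefs_in L P, P != 0, P.[a] = 0 &
     forall p, coefs_in L p -> p.[a] = 0 -> (size p < size P)%N -> p = 0].
Proof.
case=> p0 H0.
pose Q (m : nat) := `[< exists p, [/\ coefs_in L p, p != 0, p.[a] = 0 & size p = m] >].
have exQ : exists m, Q m.
  by exists (size p0); apply/asboolP; exists p0; case: H0.
case: (ex_minnP exQ) => m /asboolP[P [LP Pn0 Pa szP]] minm.
exists P; split=> // p Lp pa ltp; apply/eqP; apply/negPn/negP => pn0.
have : Q (size p) by apply/asboolP; exists p.
by move/minm; rewrite leqNgt -szP ltp.
Qed.

End Closure.

(** The laws are imposed on [L] only, while [D] is defined on all of [K]: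
    successive extensions of a derivation then have the same type. *)
Definition is_derivation L (D : K -> K) : Prop :=
  [/\ forall x y, L x -> L y -> D (x - y) = D x - D y &
      forall x y, L x -> L y -> D (x * y) = x * D y + D x * y].

Section Derivation.
Variables (L : set K) (sL : is_subring L) (D : K -> K) (dD : is_derivation L D).

Lemma derB x y : L x -> L y -> D (x - y) = D x - D y. Proof. by case: dD => + _; apply. Qed.
Lemma derM x y : L x -> L y -> D (x * y) = x * D y + D x * y.
Proof. by case: dD => _; apply. Qed.
Lemma der0 : D 0 = 0.
Proof. by have L0 := subring0 sL; rewrite -[X in D X](subrr 0) derB // subrr. Qed.
Lemma derN x : L x -> D (- x) = - D x.
Proof.
by move=> Lx; rewrite -[- x in LHS]sub0r derB ?der0 ?sub0r //; exact: subring0.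
Qed.
Lemma derD x y : L x -> L y -> D (x + y) = D x + D y.
Proof.
move=> Lx Ly; rewrite -{1}[y]opprK derB ?derN ?opprK //; exact: subringN.
Qed.
Lemma der_sum (I : Type) (s : seq I) (P : pred I) (f : I -> K) :
  (forall i, P i -> L (f i)) -> D (\sum_(i <- s | P i) f i) = \sum_(i <- s | P i) D (f i).
Proof.
move=> H; elim: s => [|i s IH]; first by rewrite !big_nil der0.
rewrite !big_cons; case: ifP => Pi //; rewrite derD ?IH //; first exact: H.
exact: subring_sum.
Qed.

Let coefDm p i : (map_poly D p)`_i = D p`_i.
Proof. by rewrite coef_map_id0 ?der0. Qed.

(** Image of [p.[a]] under the derivation that extends [D] and sends [a] to [b],
    if there is one. *)
Definition dpoly a b p := (map_poly D p).[a] + p^`().[a] * b.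

Lemma dpolyB a b p q : coefs_in L p -> coefs_in L q ->
  dpoly a b (p - q) = dpoly a b p - dpoly a b q.
Proof.
move=> Lp Lq; rewrite /dpoly; have -> : map_poly D (p - q) = map_poly D p - map_poly D q.
  by apply/polyP => i; rewrite coefB !coefDm coefB derB.
by rewrite derivB !hornerD !hornerN mulrDl mulNr opprD addrACA.
Qed.
Lemma dpolyM a b p q : coefs_in L p -> coefs_in L q ->
  dpoly a b (p * q) = p.[a] * dpoly a b q + dpoly a b p * q.[a].
Proof.
move=> Lp Lq; rewrite /dpoly; have -> : map_poly D (p * q) = p * map_poly D q + map_poly D p * q.
  apply/polyP => i; rewrite coefDm coefD !coefM der_sum; last first.
    by move=> j _; apply: subringM.
  by rewrite -big_split /=; apply: eq_bigr => j _; rewrite derM // !coefDm.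
by rewrite derivM !hornerD !hornerM; ring.
Qed.
Lemma dpolyC a b x : dpoly a b x%:P = D x.
Proof.
have E : map_poly D x%:P = (D x)%:P.
  by apply/polyP => i; rewrite coefDm !coefC; case: ifP => _ //; rewrite der0.
by rewrite /dpoly E derivC !hornerC mul0r addr0.
Qed.

Lemma dpolyZ a b c p : L c -> coefs_in L p ->
  dpoly a b (c *: p) = c * dpoly a b p + D c * p.[a].
Proof.
move=> Lc Lp; rewrite -mul_polyC dpolyM ?dpolyC ?hornerC //; exact: coefs_inC.
Qed.

End Derivation.

(** If [a] is transcendental over [L] every [b] is allowed. Otherwise the least
    annihilating polynomial [P] prescribes [b], because [P'(a)] is nonzero in
    characteristic zero; by pseudo-division every other relation satisfied by
    [a] is a multiple of [P] up to a nonzero element of [L]. *)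
Lemma derivation_compatible L D a : [pchar K] =i pred0 -> is_subring L ->
  is_derivation L D ->
  exists b, forall p, coefs_in L p -> p.[a] = 0 -> dpoly D a b p = 0.
Proof.
move=> ch0 sL dD.
have [alg|tr] := pselect (exists p, [/\ coefs_in L p, p != 0 & p.[a] = 0]); last first.
  exists 0 => p Lp pa; have [->|p0] := eqVneq p 0.
    by rewrite /dpoly map_poly0 deriv0 horner0 mul0r addr0.
  by case: tr; exists p.
have [P [LP P0 Pa minP]] := min_annihilator alg.
have szP : (1 < size P)%N.
  rewrite ltnNge; apply/negP => /size1_polyC E.
  by move: Pa P0; rewrite E hornerC => ->; rewrite eqxx.
have P'0 : P^`().[a] != 0.
  apply/eqP => E; have := minP _ (coefs_in_deriv sL LP) E (lt_size_deriv P0).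
  have [k Ek] : exists k, size P = k.+2 by case: (size P) szP => [|[|k]] // _; exists k.
  move=> P'0; have : (P^`())`_k = 0 by rewrite P'0 coef0.
  rewrite coef_deriv -mulr_natr => /eqP; rewrite mulf_eq0.
  have -> : P`_k.+1 = lead_coef P by rewrite /lead_coef Ek.
  by rewrite lead_coef_eq0 (negPf P0) (iffLR (pcharf0P K) ch0).
pose b := - (map_poly D P).[a] / P^`().[a]; exists b.
have dP : dpoly D a b P = 0 by rewrite /dpoly /b mulrC divfK // subrr.
move=> p Lp pa.
have [s [q [t [Lq Lt szt E]]]] := pseudo_division sL Lp LP P0.
have t0 : t = 0.
  apply: minP => //; have := congr1 (horner^~ a) E.
  by rewrite /= hornerZ hornerD hornerM pa Pa !mulr0 add0r.
have Ls : L (lead_coef P ^+ s) by apply: subringX => //; exact: LP.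
have := congr1 (dpoly D a b) E; rewrite t0 addr0 (dpolyZ sL dD) // (dpolyM sL dD) // pa dP Pa.
rewrite !mulr0 !addr0 => /eqP; rewrite mulf_eq0 expf_eq0 lead_coef_eq0 (negPf P0).
by rewrite andbF /= => /eqP.
Qed.

Lemma derivation_adjoin L D a : [pchar K] =i pred0 -> is_subring L ->
  is_derivation L D ->
  exists D', is_derivation (adjoin L a) D' /\ forall x, L x -> D' x = D x.
Proof.
move=> ch0 sL dD; have [b Hb] := derivation_compatible a ch0 sL dD.
pose D' z := if pselect (adjoin L a z) is left H then dpoly D a b (s2val (cid2 H)) else 0.
have D'E p : coefs_in L p -> D' p.[a] = dpoly D a b p.
  move=> Lp; rewrite /D'; case: pselect => [H|[]]; last by exists p.
  case: cid2 => q /= Lq Eq; apply/eqP; rewrite -subr_eq0 -(dpolyB sL dD) //; apply/eqP/Hb.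
    exact: coefs_inB.
  by rewrite hornerD hornerN Eq subrr.
exists D'; split; last first.
  move=> x Lx; rewrite -[x in LHS](hornerC x a) D'E ?(dpolyC sL dD) //; exact: coefs_inC.
split=> _ _ [p Lp <-] [q Lq <-].
  by rewrite -hornerN -hornerD !D'E ?(dpolyB sL dD) //; exact: coefs_inB.
by rewrite -hornerM !D'E ?(dpolyM sL dD) //; exact: coefs_inM.
Qed.

Lemma derivation_adjoin_seq (s : seq K) L D : [pchar K] =i pred0 -> is_subring L ->
  is_derivation L D ->
  exists L' D', [/\ is_subring L', L `<=` L', forall x, x \in s -> L' x,
    is_derivation L' D' & forall x, L x -> D' x = D x].
Proof.
move=> ch0; elim: s L D => [|a s IH] L D sL dD; first by exists L, D; split=> // x.
have [D1 [dD1 E1]] := derivation_adjoin a ch0 sL dD.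
have [L' [D' [sL' LL' sL's dD' E']]] := IH _ _ (adjoin_subring sL a) dD1.
have LL1 : L `<=` adjoin L a by exact: adjoin_sub.
exists L', D'; split=> //.
- by move=> x /LL1/LL'.
- by move=> x; rewrite inE => /predU1P[->|/sL's//]; apply: LL'; exact: adjoin_mem.
- by move=> x Lx; rewrite E' ?E1 //; exact: LL1.
Qed.

End Subring.

(** * Extending homomorphisms into an algebraically closed field *)

Section Specializations.
Variables (K : fieldType) (F : closedFieldType).
Implicit Types (L : set K) (phi : K -> F).

(** A homomorphism from [L] to [F], as a total function for the same reason as
    derivations. *)
Definition is_specialization L phi : Prop :=
  [/\ phi 1 = 1, forall x y, L x -> L y -> phi (x - y) = phi x - phi y &
      forall x y, L x -> L y -> phi (x * y) = phi x * phi y].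

Section Hom.
Variables (L : set K) (sL : is_subring L) (phi : K -> F) (hphi : is_specialization L phi).
Lemma spec1 : phi 1 = 1. Proof. by case: hphi. Qed.
Lemma specB x y : L x -> L y -> phi (x - y) = phi x - phi y.
Proof. by case: hphi => _ + _; apply. Qed.
Lemma specM x y : L x -> L y -> phi (x * y) = phi x * phi y.
Proof. by case: hphi => _ _; apply. Qed.
Lemma spec0 : phi 0 = 0.
Proof. by have L0 := subring0 sL; rewrite -[X in phi X](subrr 0) specB // subrr. Qed.
Lemma specN x : L x -> phi (- x) = - phi x.
Proof.
by move=> Lx; rewrite -[- x in LHS]sub0r specB ?spec0 ?sub0r //; exact: subring0.
Qed.
Lemma specD x y : L x -> L y -> phi (x + y) = phi x + phi y.
Proof.
move=> Lx Ly; rewrite -{1}[y]opprK specB ?specN ?opprK //; exact: subringN.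
Qed.
Lemma spec_exp x k : L x -> phi (x ^+ k) = phi x ^+ k.
Proof.
move=> Lx; elim: k => [|k IH]; first by rewrite !expr0 spec1.
by rewrite !exprS specM ?IH //; exact: subringX.
Qed.
Lemma spec_sum (I : Type) (s : seq I) (P : pred I) (f : I -> K) :
  (forall i, P i -> L (f i)) -> phi (\sum_(i <- s | P i) f i) = \sum_(i <- s | P i) phi (f i).
Proof.
move=> H; elim: s => [|i s IH]; first by rewrite !big_nil spec0.
rewrite !big_cons; case: ifP => Pi //; rewrite specD ?IH //; first exact: H.
exact: subring_sum.
Qed.

Lemma coef_spec p i : (map_poly phi p)`_i = phi p`_i.
Proof. by rewrite coef_map_id0 ?spec0. Qed.
Lemma map_specB p q : coefs_in L p -> coefs_in L q ->
  map_poly phi (p - q) = map_poly phi p - map_poly phi q.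
Proof. by move=> Lp Lq; apply/polyP => i; rewrite coefB !coef_spec coefB specB. Qed.
Lemma map_specM p q : coefs_in L p -> coefs_in L q ->
  map_poly phi (p * q) = map_poly phi p * map_poly phi q.
Proof.
move=> Lp Lq; apply/polyP => i; rewrite coef_spec !coefM spec_sum.
  by apply: eq_bigr => j _; rewrite specM // !coef_spec.
by move=> j _; exact: subringM.
Qed.
Lemma map_specC x : map_poly phi x%:P = (phi x)%:P.
Proof. by apply/polyP => i; rewrite coef_spec !coefC; case: ifP; rewrite ?spec0. Qed.

End Hom.

Lemma exists_nonroot (p : {poly F}) : p != 0 -> exists x, p.[x] != 0.
Proof.
move=> p0; have [/size_poly1P[c c0 ->]|sz] := boolP (size p == 1)%N.
  by exists 0; rewrite hornerC.
have [sz1|sz1] := leqP (size p) 1.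
  by move: sz; rewrite eqn_leq sz1 size_poly_gt0 p0.
(* a point where [p] takes the value 1 *)
have : size (p - 1)%R != 1%N by rewrite size_polyDl ?size_polyN ?size_poly1.
case/closed_rootP => x; rewrite rootE hornerD hornerN hornerC subr_eq0 => /eqP E.
by exists x; rewrite E oner_eq0.
Qed.

Lemma spec_adjoin_of_root L a phi alpha : is_subring L -> is_specialization L phi ->
    (forall p, coefs_in L p -> p.[a] = 0 -> (map_poly phi p).[alpha] = 0) ->
  exists phi', [/\ is_specialization (adjoin L a) phi',
    forall x, L x -> phi' x = phi x &
    forall p, coefs_in L p -> phi' p.[a] = (map_poly phi p).[alpha]].
Proof.
move=> sL hphi H.
pose phi' z := if pselect (adjoin L a z) is left H
  then (map_poly phi (s2val (cid2 H))).[alpha] else 0.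
have E p : coefs_in L p -> phi' p.[a] = (map_poly phi p).[alpha].
  move=> Lp; rewrite /phi'; case: pselect => [Hp|[]]; last by exists p.
  case: cid2 => q /= Lq Eq; apply/eqP; rewrite -subr_eq0 -hornerN -hornerD.
  rewrite -(map_specB sL hphi) //; apply/eqP/H; first exact: coefs_inB.
  by rewrite hornerD hornerN Eq subrr.
have E' x : L x -> phi' x = phi x.
  move=> Lx; rewrite -[x in LHS](hornerC x a) E ?(map_specC sL hphi) ?hornerC //.
  exact: coefs_inC.
exists phi'; split=> //; split; first by rewrite E' ?(spec1 hphi) //; exact: subring1.
- move=> _ _ [p Lp <-] [q Lq <-].
  by rewrite -hornerN -hornerD !E ?(map_specB sL hphi) ?hornerD ?hornerN //; exact: coefs_inB.
- move=> _ _ [p Lp <-] [q Lq <-].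
  by rewrite -hornerM !E ?(map_specM sL hphi) ?hornerM //; exact: coefs_inM.
Qed.

(** Euclid's algorithm for the least annihilating polynomial of [a] and a
    polynomial representing a multiple of [h]: such a representative of least
    degree must be constant. *)
Lemma adjoin_divides L a h : is_subring L ->
    (exists p, [/\ coefs_in L p, p != 0 & p.[a] = 0]) -> adjoin L a h -> h != 0 ->
  exists k c, [/\ adjoin L a k, L c, c != 0 & h * k = c].
Proof.
move=> sL alg [p Lp ph] h0.
have [P [LP P0 Pa minP]] := min_annihilator alg.
pose Q (m : nat) := `[< exists r, [/\ coefs_in L r, r.[a] != 0,
  exists2 k, adjoin L a k & r.[a] = h * k & size r = m] >].
have exQ : exists m, Q m.
  exists (size p); apply/asboolP; exists p; split=> //; first by rewrite ph.
  by exists 1; rewrite ?mulr1 //; apply: subring1; exact: adjoin_subring.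
case: (ex_minnP exQ) => m /asboolP[r [Lr ra [k Lk Ek] szr]] minm.
have minr q : coefs_in L q -> q.[a] != 0 ->
    (exists2 k, adjoin L a k & q.[a] = h * k) -> (size r <= size q)%N.
  by move=> Lq qa Hq; rewrite szr; apply: minm; apply/asboolP; exists q.
have sA := adjoin_subring sL a.
have r0 : r != 0 by apply: contra_neq ra => ->; rewrite horner0.
have ltrP : (size r < size P)%N.
  have [s [q [t [Lq Lt szt E]]]] := pseudo_division sL Lr LP P0.
  have Ea : t.[a] = lead_coef P ^+ s * r.[a].
    by rewrite -hornerZ E hornerD hornerM Pa mulr0 add0r.
  apply: leq_ltn_trans szt; apply: minr => //.
    by rewrite Ea mulf_neq0 // expf_neq0 // lead_coef_eq0.
  exists (lead_coef P ^+ s * k); last by rewrite Ea Ek mulrCA.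
  apply: subringM => //; apply: subringX => //; apply: adjoin_sub => //; exact: LP.
have sz1 : (size r <= 1)%N.
  rewrite leqNgt; apply/negP => gt1.
  have [s [q [t [Lq Lt szt E]]]] := pseudo_division sL LP Lr r0.
  have Ea : t.[a] = - (q.[a] * r.[a]).
    by apply/eqP; rewrite -addr_eq0 addrC -hornerM -hornerD -E hornerZ Pa mulr0.
  have ta : t.[a] = 0.
    apply/eqP/negPn/negP => ta; have := szt; rewrite ltnNge minr //.
    exists (- (q.[a] * k)); last by rewrite Ea Ek mulrN mulrCA.
    by apply: subringN => //; apply: subringM => //; exists q.
  have t0 : t = 0 by apply: minP => //; exact: ltn_trans szt ltrP.
  have qa : q.[a] = 0.
    by move/eqP: Ea; rewrite ta eq_sym oppr_eq0 mulf_eq0 (negPf ra) orbF => /eqP.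
  have ls0 : lead_coef r ^+ s != 0 by rewrite expf_neq0 // lead_coef_eq0.
  have q0 : q != 0.
    apply: contra_neq P0 => q0; apply/eqP.
    by move/eqP: E; rewrite q0 mul0r add0r t0 scaler_eq0 (negPf ls0).
  have lt : (size q < size P)%N.
    rewrite -(size_scale P ls0) E t0 addr0 size_mul //.
    by case: (size r) gt1 => [|[|u]] // _; rewrite !addnS /= ltnS leq_addr.
  by move: q0; rewrite (minP q Lq qa lt) eqxx.
exists k, r.[a]; split=> //; rewrite (size1_polyC sz1) hornerC; exact: Lr.
Qed.

(** In the algebraic case [a] goes to a root of the image of its least
    annihilating polynomial, which exists if the leading coefficient survives;
    [h] survives since it divides a surviving element of [L]. In the
    transcendental case [a] may go to all but finitely many values. *)
Lemma spec_adjoin L a h : is_subring L -> adjoin L a h -> h != 0 ->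
  exists h', [/\ L h', h' != 0 & forall phi, is_specialization L phi -> phi h' != 0 ->
    exists phi', [/\ is_specialization (adjoin L a) phi', forall x, L x -> phi' x = phi x &
                     phi' h != 0]].
Proof.
move=> sL Lh h0.
have [alg|tr] := pselect (exists p, [/\ coefs_in L p, p != 0 & p.[a] = 0]).
  have [k [c [Lk Lc c0 Ec]]] := adjoin_divides sL alg Lh h0.
  have [P [LP P0 Pa minP]] := min_annihilator alg.
  exists (lead_coef P * c); split.
  - by apply: subringM => //; exact: LP.
  - by rewrite mulf_neq0 // lead_coef_eq0.
  move=> phi hphi; rewrite (specM hphi) //; last exact: LP.
  rewrite mulf_eq0 negb_or => /andP[lP phic].
  have : size (map_poly phi P) != 1%N.
    have -> : size (map_poly phi P) = size P.
      apply/eqP; rewrite eqn_leq size_poly /=; apply: contraNT lP => lt.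
      have szP : size P = (size P).-1.+1 by rewrite prednK // size_poly_gt0.
      by rewrite lead_coefE -(coef_spec sL hphi) nth_default // -ltnS -szP ltnNge.
    apply/negP => /size_poly1P[d d0 E]; move: Pa d0; rewrite E hornerC => ->.
    by rewrite eqxx.
  case/closed_rootP => alpha /rootP ralpha.
  have H p : coefs_in L p -> p.[a] = 0 -> (map_poly phi p).[alpha] = 0.
    move=> Lp pa; have [s [q [t [Lq Lt szt E]]]] := pseudo_division sL Lp LP P0.
    have t0 : t = 0.
      apply: minP => //; have := congr1 (horner^~ a) E.
      by rewrite /= hornerZ hornerD hornerM pa Pa !mulr0 add0r.
    have Ls : L (lead_coef P ^+ s) by apply: subringX => //; exact: LP.
    have := congr1 (fun p => (map_poly phi p).[alpha]) E.
    rewrite t0 addr0 -mul_polyC !(map_specM sL hphi) ?(map_specC sL hphi) //; last first.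
      exact: coefs_inC.
    rewrite !hornerM hornerC ralpha mulr0 => /eqP; rewrite mulf_eq0.
    by rewrite (spec_exp sL hphi) ?expf_eq0 ?(negPf lP) ?andbF => [/eqP|]; last exact: LP.
  have [phi' [h1 h2 h3]] := spec_adjoin_of_root sL hphi H.
  exists phi'; split=> //; apply: contraNneq phic => phih.
  by rewrite -h2 // -Ec (specM h1) // phih mul0r.
have [p Lp ph] := Lh.
have p0 : p != 0 by apply: contra_neq h0 => p0; rewrite -ph p0 horner0.
exists (lead_coef p); split; [exact: Lp|by rewrite lead_coef_eq0|].
move=> phi hphi lp.
have [|alpha ralpha] := @exists_nonroot (map_poly phi p).
  by apply: contra_neq lp => E; rewrite lead_coefE -(coef_spec sL hphi) E coef0.
have [|phi' [h1 h2 h3]] := @spec_adjoin_of_root L a phi alpha sL hphi.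
  move=> q Lq qa; have [->|q0] := eqVneq q 0; last by case: tr; exists q.
  by rewrite map_poly0 horner0.
by exists phi'; split=> //; rewrite -ph h3.
Qed.

Lemma spec_adjoin_seq (s : seq K) L h : is_subring L ->
    foldl (@adjoin K) L s h -> h != 0 ->
  exists h', [/\ L h', h' != 0 & forall phi, is_specialization L phi -> phi h' != 0 ->
    exists phi', [/\ is_specialization (foldl (@adjoin K) L s) phi',
                     forall x, L x -> phi' x = phi x & phi' h != 0]].
Proof.
elim: s L h => [|a s IH] L h sL /= Lh h0.
  by exists h; split=> // phi hphi phih; exists phi.
have [h1 [Lh1 h10 E1]] := IH _ _ (adjoin_subring sL a) Lh h0.
have [h2 [Lh2 h20 E2]] := spec_adjoin sL Lh1 h10.
exists h2; split=> // phi hphi /E2 -/(_ hphi)[phi1 [p1 p2 p3]].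
have [phi' [q1 q2 q3]] := E1 _ p1 p3.
exists phi'; split=> // x Lx; rewrite q2 ?p2 //; exact: adjoin_sub.
Qed.

Lemma foldl_adjoin_subring (s : seq K) L : is_subring L -> is_subring (foldl (@adjoin K) L s).
Proof. by elim: s L => //= a s IH L sL; apply: IH; exact: adjoin_subring. Qed.

Lemma foldl_adjoin_sub (s : seq K) L : is_subring L -> L `<=` foldl (@adjoin K) L s.
Proof.
elim: s L => [|a s IH] L sL /=; first (by []);
apply: subset_trans (IH _ (adjoin_subring sL a)).
exact: adjoin_sub.
Qed.

Lemma foldl_adjoin_mem (s : seq K) L x : is_subring L -> x \in s -> foldl (@adjoin K) L s x.
Proof.
elim: s L => //= a s IH L sL; rewrite inE => /predU1P[->|xs]; last first.
  by apply: IH => //; exact: adjoin_subring.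
by apply: foldl_adjoin_sub; [exact: adjoin_subring|exact: adjoin_mem].
Qed.

End Specializations.

(** * Evaluation of multivariate polynomials *)

Lemma eq_mmap n (R : nzRingType) (S : comNzRingType) (k k' : R -> S) (h h' : 'I_n -> S)
  (f : {mpoly R[n]}) : k =1 k' -> h =1 h' -> mmap k h f = mmap k' h' f.
Proof.
move=> Ek Eh; rewrite /mmap; apply: eq_bigr => m _; rewrite Ek; congr (_ * _).
by rewrite /mmap1; apply: eq_bigr => i _; rewrite Eh.
Qed.

Lemma mmap_rmorphism n (R S : comNzRingType) (pi : {rmorphism {mpoly R[n]} -> S}) f :
  mmap (pi \o @mpolyC n R) (fun i => pi 'X_i) f = pi f.
Proof.
rewrite {2}[f]mpolyE rmorph_sum /mmap; apply: eq_bigr => m _.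
rewrite -mul_mpolyC rmorphM /=; congr (_ * _).
rewrite mpolyXE_id rmorph_prod /mmap1; apply: eq_bigr => i _.
by rewrite rmorphXn.
Qed.

Section MpolyTools.
Variable (R : comNzRingType).

Lemma mpoly_generators_ind n (P : {mpoly R[n]} -> Prop) :
    (forall c, P c%:MP) -> (forall i, P 'X_i) ->
    (forall f g, P f -> P g -> P (f + g)) -> (forall f g, P f -> P g -> P (f * g)) ->
  forall f, P f.
Proof.
move=> PC PX PD PM f; rewrite [f]mpolyE.
apply: big_ind => // [|m _]; first by rewrite -mpolyC0; exact: PC.
rewrite -mul_mpolyC; apply: (PM) => //.
rewrite mpolyXE_id; apply: (big_ind P) => [|f1 g1|i _]; [by rewrite -mpolyC1; exact: PC|exact: PM|].
elim: (m i) => [|k IH]; first by rewrite expr0 -mpolyC1; exact: PC.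
by rewrite exprS; exact: PM.
Qed.

Lemma mmapXU n (S : comNzRingType) (k : {rmorphism R -> S}) (h : 'I_n -> S) i :
  mmap k h 'X_i = h i.
Proof. by rewrite mmapX mmap1U. Qed.

Lemma mmap_mmap n d (S : comNzRingType) (k : {rmorphism R -> S}) (eta : 'I_n -> S)
    (y : 'I_d -> {mpoly R[n]}) P :
  mmap k (fun j => mmap k eta (y j)) P = mmap k eta (mmap (@mpolyC n R) y P).
Proof.
elim/mpoly_generators_ind: P => [c|i|P Q EP EQ|P Q EP EQ].
- by rewrite !mmapC.
- by rewrite !mmapXU.
- by rewrite !rmorphD /= EP EQ.
- by rewrite !rmorphM /= EP EQ.
Qed.

Lemma mmap_polyC_eval n d (y : 'I_d -> {mpoly R[n]}) P (x : 'I_n -> R) :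
  (mmap (@mpolyC n R) y P).@[x] = P.@[fun j => (y j).@[x]].
Proof. by rewrite /meval (mmap_mmap idfun). Qed.

Lemma muniXU n (i : 'I_n) : muni 'X_(widen_ord (leqnSn n) i) = ('X_i)%:P :> {poly {mpoly R[n]}}.
Proof.
rewrite muniE msuppX big_seq1 mcoeffX eqxx scale1r mnm1E.
rewrite -val_eqE /= (ltn_eqF (ltn_ord i)) /= expr0 alg_polyC; congr (_%:P).
congr mpolyX; apply/mnmP => j; rewrite mnmE !mnm1E -!val_eqE /=.
by [].
Qed.

Lemma muniXmax n : muni 'X_ord_max = 'X :> {poly {mpoly R[n]}}.
Proof.
rewrite muniE msuppX big_seq1 mcoeffX eqxx scale1r mnm1E eqxx expr1.
have -> : [multinom (U_(ord_max) (widen_ord (leqnSn n) i)) | i < n]%MM = 0%MM.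
  apply/mnmP => j; rewrite mnmE mnm1E mnm0E -val_eqE /=.
  by rewrite gtn_eqF // ltn_ord.
by rewrite mpolyX0 scale1r.
Qed.

(** Evaluating the last variable separately allows induction on the number of
    variables. *)
Lemma mmap_muni n (S : comNzRingType) (k : {rmorphism R -> S}) (h : 'I_n.+1 -> S) P :
  mmap k h P =
  (map_poly (mmap k (fun i => h (widen_ord (leqnSn n) i))) (muni P)).[h ord_max].
Proof.
elim/mpoly_generators_ind: P => [c|i|f g Ef Eg|f g Ef Eg].
- by rewrite muniC map_polyC hornerC /= !mmapC.
- rewrite mmapXU; have [lt|ge] := ltnP i n.
    have -> : i = widen_ord (leqnSn n) (Ordinal lt) by apply: val_inj.
    by rewrite muniXU map_polyC hornerC /= mmapXU.
  have -> : i = ord_max by apply/val_inj/eqP; rewrite eqn_leq ge -ltnS ltn_ord.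
  by rewrite muniXmax map_polyX hornerX.
- by rewrite !rmorphD /= hornerD Ef Eg.
- by rewrite !rmorphM /= hornerM Ef Eg.
Qed.

Lemma muni_inj0 n (P : {mpoly R[n.+1]}) : muni P = 0 -> P = 0.
Proof.
move=> E.
have := mmap_muni (@mpolyC n.+1 R) (fun i => 'X_i) P; rewrite E rmorph0 horner0.
have -> : mmap (@mpolyC n.+1 R) (fun i => 'X_i) P = P \mPo [tuple 'X_i | i < n.+1].
  by apply: eq_mmap => // i; rewrite tnth_mktuple.
by rewrite comp_mpoly_id.
Qed.

End MpolyTools.

Lemma mpoly_nonroot (F : closedFieldType) n (P : {mpoly F[n]}) :
  P != 0 -> exists x : 'I_n -> F, P.@[x] != 0.
Proof.
elim: n P => [|n IH] P P0.
  exists (fun => 0); rewrite (nvar0_mpolyC P) mevalC; apply: contra_neq P0 => E.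
  by rewrite (nvar0_mpolyC P) E mpolyC0.
have mP0 : muni P != 0 by apply: contra_neq P0; exact: muni_inj0.
have [|x Hx] := IH (lead_coef (muni P)); first by rewrite lead_coef_eq0.
have [|t Ht] := @exists_nonroot F (map_poly (meval x) (muni P)).
  apply: contra_neq Hx => E; have := coef_map (meval x) (muni P) (size (muni P)).-1.
  by rewrite E coef0.
exists (fun i => if insub (val i) is Some j then x j else t).
rewrite /meval (mmap_muni idfun); apply: contra_neq Ht => E; rewrite -[RHS]E.
rewrite insubF ?ltnn //; congr horner; apply/polyP => i; rewrite !coef_map /=.
by apply: eq_mmap => // j; rewrite insubT //= => lt; congr x; apply: val_inj.
Qed.

(** * The Zariski topology is noetherian *)

Section Dickson.

Lemma increasing_lt (s : nat -> nat) : (forall i, s i < s i.+1)%N ->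
  forall i j, (i < j)%N -> (s i < s j)%N.
Proof.
move=> H i; elim=> // j IH; rewrite ltnS leq_eqVlt => /predU1P[->|/IH lt] //.
exact: ltn_trans lt (H j).
Qed.

Lemma nondecreasing_subsequence (f : nat -> nat) :
  exists s : nat -> nat, (forall i j, i < j -> s i < s j)%N /\
    (forall i j, i < j -> f (s i) <= f (s j))%N.
Proof.
have H N : exists i, (N <= i)%N /\ forall j, (i <= j)%N -> (f i <= f j)%N.
  pose Q m := `[< exists2 i, (N <= i)%N & f i = m >].
  have exQ : exists m, Q m by exists (f N); apply/asboolP; exists N.
  case: (ex_minnP exQ) => m /asboolP[i Ni Ei] minm; exists i; split=> // j ij.
  by rewrite Ei; apply: minm; apply/asboolP; exists j => //; exact: leq_trans ij.
have [g Hg] := choice H.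
pose s := fix s k := if k is k'.+1 then g (s k').+1 else g 0%N.
have lts : forall i j, (i < j)%N -> (s i < s j)%N.
  by apply: increasing_lt => i /=; case: (Hg (s i).+1).
exists s; split=> // i j ij; have mins : forall j, (s i <= j)%N -> (f (s i) <= f j)%N.
  by case: i {ij} => [|i] /=; apply: (Hg _).2.
by apply: mins; apply: ltnW; exact: lts.
Qed.

(** Pass to a subsequence that is nondecreasing in one variable after another. *)
Lemma dickson n (m : nat -> 'X_{1..n}) : exists i j, (i < j)%N /\ (m i <= m j)%MM.
Proof.
suff [s [lts Hs]] : exists s : nat -> nat, (forall i j, i < j -> s i < s j)%N /\
    forall k, k \in enum 'I_n -> forall i j, (i < j)%N -> (m (s i) k <= m (s j) k)%N.
  exists (s 0%N), (s 1%N); split; first exact: lts.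
  by apply/mnm_lepP => k; apply: Hs; rewrite ?mem_enum.
elim: (enum 'I_n) => [|k r [s [lts Hs]]]; first by exists id.
have [t [ltt Ht]] := nondecreasing_subsequence (fun i => m (s i) k).
exists (s \o t); split=> [i j ij|l]; first by apply: lts; exact: ltt.
rewrite inE => /predU1P[->|lr] i j ij; first exact: Ht.
by apply: Hs => //; exact: ltt.
Qed.

End Dickson.

Section Zariski.
Variables (F : closedFieldType) (n : nat).
Local Notation V := 'rV[F]_n.
Local Notation A := {mpoly F[n]}.
Implicit Types (X Y Z : set V) (f g : A).

Lemma zariski_closedP X : zariski_closed X <->
  X = zero_locus (vanishing_ideal X).
Proof.
split=> [[S ->]|E]; last by exists (vanishing_ideal X).
apply/seteqP; split=> x Hx f Hf; first exact: Hf.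
by apply: Hx => y; apply.
Qed.

Lemma vanishing_idealS X Y : X `<=` Y -> vanishing_ideal Y `<=` vanishing_ideal X.
Proof. by move=> XY f Yf x /XY /Yf. Qed.

Lemma zariski_closure_locus X : zariski_closure X = zero_locus (vanishing_ideal X).
Proof.
apply/seteqP; split=> x Hx.
  by apply: Hx; [exists (vanishing_ideal X)|move=> y Xy f; apply].
move=> B [S ->] XS f Sf; apply: Hx => y /XS; exact.
Qed.

Lemma closed_zero f : zariski_closed [set x : V | f.@[x ord0] = 0].
Proof.
exists [set f]; apply/seteqP; split=> x /= Hx; last exact: Hx.
by move=> _ ->.
Qed.

Lemma zariski_closedI X Y : zariski_closed X -> zariski_closed Y ->
  zariski_closed (X `&` Y).
Proof.
move=> [S ->] [T ->]; exists (S `|` T); apply/seteqP; split=> x.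
  by move=> [Sx Tx] f [/Sx|/Tx].
by move=> H; split=> f Hf; apply: H; [left|right].
Qed.

Lemma vanishing_idealB X f g : vanishing_ideal X f -> vanishing_ideal X g ->
  vanishing_ideal X (f - g).
Proof. by move=> Xf Xg x Xx; rewrite mevalB Xf ?Xg ?subrr. Qed.

Lemma vanishing_idealD X f g : vanishing_ideal X f -> vanishing_ideal X g ->
  vanishing_ideal X (f + g).
Proof. by move=> Xf Xg x Xx; rewrite mevalD Xf ?Xg ?addr0. Qed.

Lemma vanishing_idealM X f g : vanishing_ideal X g -> vanishing_ideal X (f * g).
Proof. by move=> Xg x Xx; rewrite mevalM Xg ?mulr0. Qed.

Lemma vanishing_ideal0 X : vanishing_ideal X 0.
Proof. by move=> x _; rewrite meval0. Qed.

(** A function of minimal lead monomial among those separating [Y] from [X]: it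
    cannot be reduced, which bounds the length of decreasing chains. *)
Lemma separating_lead X Y : zariski_closed Y -> Y `<` X -> exists f,
  [/\ vanishing_ideal Y f, ~ vanishing_ideal X f &
    forall g, vanishing_ideal Y g -> ~ vanishing_ideal X g -> ~ (mlead g < mlead f)%O].
Proof.
move=> cY [YX nXY].
have [f0 [Yf0 Xf0]] : exists f, vanishing_ideal Y f /\ ~ vanishing_ideal X f.
  apply: contrapT => H; apply: nXY => x Xx.
  move/zariski_closedP: cY => ->.
  move=> f Yf; have [Xf|Xf] := pselect (vanishing_ideal X f); first exact: Xf.
  by case: H; exists f.
have [m Em] : exists m, m = mlead f0 by eexists.
elim/(well_founded_ind (@ltom_wf n)): m f0 Yf0 Xf0 Em => m IH f Yf Xf Em.
have [[g [Yg Xg lt]]|H] := pselect (exists g, [/\ vanishing_ideal Y g,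
  ~ vanishing_ideal X g & (mlead g < mlead f)%O]).
  by apply: (IH (mlead g) _ g) => //; rewrite Em.
by exists f; split=> // g Yg Xg lt; apply: H; exists g.
Qed.

(** Hilbert's basis theorem as a descending chain condition: by Dickson's lemma
    the lead monomial of some [f i] divides that of a later [f j]; subtracting a
    multiple of [f i] from [f j] lowers the lead, against its minimality. *)
Lemma no_decreasing_sequence (Z : nat -> set V) :
  (forall k, zariski_closed (Z k)) -> ~ (forall k, Z k.+1 `<` Z k).
Proof.
move=> cZ decZ.
have [f Hf] := choice (fun k => separating_lead (cZ k.+1) (decZ k)).
have subZ : forall i j, (i <= j)%N -> Z j `<=` Z i.
  move=> i j /subnK <-; elim: (j - i)%N => // k IH.
  by apply: subset_trans IH; exact: (decZ _).1.
have [i [j [ij le]]] := dickson (fun k => mlead (f k)).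
have [Zfj nZfj minj] := Hf j; have [Zfi nZfi _] := Hf i.
have fi0 : mleadc (f i) != 0.
  by rewrite mleadc_eq0; apply: contra_not_neq nZfi => ->; exact: vanishing_ideal0.
have fj0 : mleadc (f j) != 0.
  by rewrite mleadc_eq0; apply: contra_not_neq nZfj => ->; exact: vanishing_ideal0.
pose c := mleadc (f j) / mleadc (f i).
have c0 : c != 0 by rewrite mulf_neq0 ?invr_eq0.
pose h := c *: ('X_[mlead (f j) - mlead (f i)] * f i).
have Zh : vanishing_ideal (Z j) h.
  rewrite /h -mul_mpolyC; do 2!apply: vanishing_idealM.
  by apply: vanishing_idealS Zfi; exact: subZ.
have X0 m : 'X_[F, m] != 0 by rewrite -mleadc_eq0 mleadXm mcoeffX eqxx oner_eq0.
have lh : mlead h = mlead (f j).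
  rewrite /h mleadZ // mleadM //; last by rewrite -mleadc_eq0.
  by rewrite mleadXm submK.
have ch : mleadc h = mleadc (f j).
  have fi1 : f i != 0 by rewrite -mleadc_eq0.
  by rewrite /h mleadcZE mleadM // mleadcM mleadXm mcoeffX eqxx mul1r /c divfK.
have nZd : ~ vanishing_ideal (Z j) (f j - h).
  by move=> Zd; apply: nZfj; rewrite -[f j](subrK h); exact: vanishing_idealD.
have d0 : f j - h != 0 by apply: contra_not_neq nZd => ->; exact: vanishing_ideal0.
apply: (minj (f j - h)) => //.
  by apply: vanishing_idealB => //; apply: vanishing_idealS Zh; exact: (decZ j).1.
rewrite lt_neqAle (le_trans (mleadB_le _ _)) ?andbT; last by rewrite lh joinxx.
apply/eqP => E; move: d0; rewrite -mleadc_eq0 E mcoeffB.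
by rewrite -{2}lh ch subrr eqxx.
Qed.

Lemma zariski_closed_ind (P : set V -> Prop) :
    (forall X, zariski_closed X -> (forall Y, zariski_closed Y -> Y `<` X -> P Y) -> P X) ->
  forall X, zariski_closed X -> P X.
Proof.
move=> IH X cX; apply: contrapT => nPX.
pose T := {Y : set V | zariski_closed Y /\ ~ P Y}.
have Hstep (t : T) : exists u : T, sval u `<` sval t.
  case: t => Y [cY nPY] /=; apply: contrapT => H; apply: nPY; apply: IH => // Z cZ ZY.
  by apply: contrapT => nPZ; apply: H; exists (exist _ Z (conj cZ nPZ)).
have [next Hnext] := choice Hstep.
pose s k : T := iter k next (exist _ X (conj cX nPX)).
apply: (@no_decreasing_sequence (fun k => sval (s k))) => k.
  by case: (s k) => Y [].
exact: Hnext.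
Qed.

Lemma zariski_trichotomy X : zariski_closed X ->
  [\/ X = set0, irreducible_closed (@zariski_closed F n) X |
   exists B C, [/\ zariski_closed B, zariski_closed C, B `<` X, C `<` X & X = B `|` C]].
Proof.
move=> cX; have [/eqP X0|/set0P X0] := boolP (X == set0); first exact: Or31.
have [irr|nirr] := pselect (irreducible_closed (@zariski_closed F n) X); first exact: Or32.
apply: Or33.
have [B [C [cB cC XBC nB nC]]] : exists B C, [/\ zariski_closed B, zariski_closed C,
    X `<=` B `|` C, ~ X `<=` B & ~ X `<=` C].
  apply: contrapT => H; apply: nirr; split=> // B C cB cC XBC.
  apply: contrapT => /not_orP[nB nC]; apply: H; by exists B, C.
have step D : ~ X `<=` D -> X `&` D `<` X.
  move=> nD; split; first exact: subIsetl.
  by move=> H; apply: nD => x /H[].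
exists (X `&` B), (X `&` C); split.
- exact: zariski_closedI.
- exact: zariski_closedI.
- exact: step.
- exact: step.
- by rewrite -setIUr; apply/esym/setIidPl.
Qed.

Lemma irreducible_decomposition X : zariski_closed X ->
  exists s : seq (set V),
    (forall k, (k < size s)%N -> irreducible_closed (@zariski_closed F n) (nth set0 s k)) /\
    (forall x, X x <-> exists2 k, (k < size s)%N & nth set0 s k x).
Proof.
move: X; apply: zariski_closed_ind => X cX IH.
have [->|irr|[B [C [cB cC ltB ltC ->]]]] := zariski_trichotomy cX.
- by exists [::]; split=> // x; split=> // -[].
- by exists [:: X]; split=> [[|]//|x]; split=> [Xx|[[|]]//]; exists 0%N.
have [s1 [irr1 E1]] := IH _ cB ltB.
have [s2 [irr2 E2]] := IH _ cC ltC.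
exists (s1 ++ s2); split=> [k|x].
  rewrite size_cat nth_cat; case: (ltnP k (size s1)) => [lt _|le lt]; first exact: irr1.
  by apply: irr2; rewrite ltn_subLR.
split=> [[/E1[k lt Hk]|/E2[k lt Hk]]|[k]].
    by exists k; rewrite ?size_cat ?ltn_addr // nth_cat lt.
  exists (size s1 + k)%N; rewrite ?size_cat ?ltn_add2l // nth_cat.
  by rewrite ltnNge leq_addr /= addKn.
rewrite size_cat nth_cat; case: (ltnP k (size s1)) => [lt _ Hk|le lt Hk].
  by left; apply/E1; exists k.
right; apply/E2.
by exists (k - size s1)%N => //; rewrite ltn_subLR.
Qed.

(** Irreducibility of the Zariski closure of [X] in algebraic terms; it is used
    for sets that are not closed, such as the conormal bundle. *)
Definition prime_vanishing X : Prop :=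
  X !=set0 /\ forall f g, vanishing_ideal X (f * g) ->
    vanishing_ideal X f \/ vanishing_ideal X g.

Lemma irreducible_prime X : irreducible_closed (@zariski_closed F n) X ->
  prime_vanishing X.
Proof.
move=> [_ X0 irr]; split=> // f g Xfg.
case: (irr _ _ (closed_zero f) (closed_zero g)).
- move=> x /Xfg; rewrite mevalM => /eqP; rewrite mulf_eq0.
  by case/orP => /eqP; [left|right].
- by left.
- by right.
Qed.

End Zariski.

(** * Generic points *)

Definition is_prime_ideal (R : comNzRingType) (I : set R) : Prop :=
  [/\ I 0, ~ I 1, forall x y, I x -> I y -> I (x + y), forall a x, I x -> I (a * x)
    & forall x y, I (x * y) -> I x \/ I y].

Section ResidueDomain.
Variables (R : comNzRingType) (I : set R) (hI : is_prime_ideal I).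

(** The proof is an argument of the predicate, so that instances on the predicate
    can depend on it. *)
Definition prime_pred of is_prime_ideal I : {pred R} := fun x => `[< I x >].
Local Notation P := (prime_pred hI).

Lemma prime_pred_ideal : idealr_closed P.
Proof.
have [I0 I1 ID IM _] := hI; split; first exact/asboolP.
  by apply/negP => /asboolP.
by move=> a u v /asboolP Iu /asboolP Iv; apply/asboolP/ID => //; exact: IM.
Qed.

Lemma prime_pred_prime : prime_idealr_closed P.
Proof.
have [_ _ _ _ Ip] := hI => u v /asboolP/Ip[?|?]; apply/orP; [left|right]; exact/asboolP.
Qed.

HB.instance Definition _ := isIdealr.Build R P prime_pred_ideal.
HB.instance Definition _ := isPrimeIdealrClosed.Build R P prime_pred_prime.

Definition residue_domain : Type := {ideal_quot (P : prime_idealr R)}.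
HB.instance Definition _ := GRing.ComNzRing.on residue_domain.

Let unitp : {pred residue_domain} := fun x => `[< exists y, y * x = 1 >].
Let invp x : residue_domain :=
  if pselect (exists y : residue_domain, y * x = 1) is left h then projT1 (cid h) else x.

Let mulVp : {in unitp, left_inverse 1 invp *%R}.
Proof.
move=> x /asboolP h; rewrite /invp; case: pselect => // h'.
by case: cid.
Qed.
Let unitPlp x y : y * x = 1 -> unitp x.
Proof. by move=> yx; apply/asboolP; exists y. Qed.
Let invp_out : {in [predC unitp], invp =1 id}.
Proof. by move=> x /negP h; rewrite /invp; case: pselect => // h'; case: h; exact/asboolP. Qed.

HB.instance Definition _ := GRing.ComNzRing_hasMulInverse.Build residue_domain
  mulVp unitPlp invp_out.

Lemma residue_domain_integral (x y : residue_domain) :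
  x * y = 0 -> (x == 0) || (y == 0).
Proof. exact: Quotient.rquot_IdomainAxiom. Qed.

HB.instance Definition _ := GRing.ComUnitRing_isIntegral.Build residue_domain
  residue_domain_integral.

Definition residue_field : fieldType := {fraction residue_domain}.

Local Notation Q := ({ideal_quot (P : prime_idealr R)}).
Definition to_residue : {rmorphism R -> Q} := (\pi_Q)%qT.
Definition residue : {rmorphism R -> residue_field} :=
  (@FracField.tofrac residue_domain) \o (to_residue : R -> residue_domain).

Lemma residue_eq0 x : residue x = 0 <-> I x.
Proof.
have E : (to_residue x == 0 :> residue_domain) = `[< I x >].
  rewrite -(rmorph0 to_residue) /to_residue /= -Quotient.idealrBE subr0.
  by [].
rewrite /residue /=; split=> [/eqP|Ix]; first by rewrite tofrac_eq0 E => /asboolP.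
by apply/eqP; rewrite tofrac_eq0 E; exact/asboolP.
Qed.

Lemma residue_fraction (z : residue_field) :
  exists x y, residue y != 0 /\ z = residue x / residue y.
Proof.
suff [a [b [b0 zb]]] : exists a b : residue_domain,
    b != 0 /\ z * FracField.tofrac b = FracField.tofrac a.
  exists (repr (a : Q)), (repr (b : Q)).
  have toK (c : Q) : to_residue (repr c) = c by rewrite /to_residue /= reprK.
  by rewrite /residue /= !toK -zb; split; rewrite ?mulfK ?tofrac_eq0.
elim/quotW: z => r; exists (frac r).1, (frac r).2; split; first exact: denom_ratioP.
unlock FracField.tofrac; rewrite -[LHS]FracField.pi_mul; apply/eqmodP => /=.
rewrite FracField.equivfE /FracField.mulf !numden_Ratio ?oner_eq0 ?mulr1 ?denom_ratioP //.
by rewrite mulrC.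
Qed.
End ResidueDomain.

Section GenericPoint.
Variables (F : closedFieldType) (n : nat).
Implicit Types (A : set 'rV[F]_n).

(** The generic point of the closure of [A], given by coordinates in an extension
    of [F]. Statements about general points of [A] become linear algebra over [K]. *)
Definition is_generic_point A (K : fieldType) (iota : {rmorphism F -> K}) (eta : 'rV[K]_n) :=
  forall f : {mpoly F[n]}, mmap iota (eta ord0) f = 0 <-> vanishing_ideal A f.

(** [K] is the function field of the closure of [A]; that its elements are
    fractions serves to turn vectors over [K] into polynomial vectors. *)
Lemma exists_generic_point A : prime_vanishing A ->
  exists (K : fieldType) (iota : {rmorphism F -> K}) (eta : 'rV[K]_n),
    is_generic_point A iota eta /\
    forall z : K, exists f g, mmap iota (eta ord0) g != 0 /\
      z = mmap iota (eta ord0) f / mmap iota (eta ord0) g.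
Proof.
move=> [[x0 Ax0] primeA].
have hI : is_prime_ideal (vanishing_ideal A).
  split; [exact: vanishing_ideal0| |exact: vanishing_idealD|exact: vanishing_idealM|exact: primeA].
  by move=> /(_ _ Ax0); rewrite meval1 => /eqP; rewrite oner_eq0.
pose iota : {rmorphism F -> residue_field hI} :=
  residue hI \o (@mpolyC n F : {rmorphism F -> {mpoly F[n]}}).
pose eta := \row_i residue hI 'X_i.
have E f : mmap iota (eta ord0) f = residue hI f.
  by rewrite -(mmap_rmorphism (residue hI) f); apply: eq_mmap => i; rewrite // mxE.
exists (residue_field hI), iota, eta; split=> [f|z].
  by rewrite E; exact: residue_eq0.
have [f [g [g0 ->]]] := residue_fraction z.
by exists f, g; rewrite !E.
Qed.

End GenericPoint.

(** * Tangent vectors at generic points, and ranks of Jacobians *)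

Section Differentials.
Variables (F K : comNzRingType) (iota : {rmorphism F -> K}).

Definition differential n (f : {mpoly F[n]}) (theta : 'I_n -> K) : 'rV[K]_n :=
  \row_i mmap iota theta f^`M(i).

Definition dpair n (f : {mpoly F[n]}) (theta v : 'I_n -> K) : K :=
  \sum_i mmap iota theta f^`M(i) * v i.

(** Zariski tangent space of the closure of the point [theta]. *)
Definition generic_tangent n (theta v : 'I_n -> K) : Prop :=
  forall f : {mpoly F[n]}, mmap iota theta f = 0 -> dpair f theta v = 0.

Lemma dpairD n (f g : {mpoly F[n]}) theta v :
  dpair (f + g) theta v = dpair f theta v + dpair g theta v.
Proof.
rewrite /dpair -big_split /=; apply: eq_bigr => i _.
by rewrite mderivD rmorphD /= mulrDl.
Qed.

Lemma dpairB n (f g : {mpoly F[n]}) theta v :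
  dpair (f - g) theta v = dpair f theta v - dpair g theta v.
Proof.
rewrite /dpair -sumrB; apply: eq_bigr => i _.
by rewrite mderivB rmorphB /= mulrBl.
Qed.

Lemma dpairM n (f g : {mpoly F[n]}) theta v :
  dpair (f * g) theta v = mmap iota theta f * dpair g theta v
    + dpair f theta v * mmap iota theta g.
Proof.
rewrite /dpair mulr_sumr mulr_suml -big_split /=; apply: eq_bigr => i _.
by rewrite mderivM rmorphD !rmorphM /=; ring.
Qed.

Lemma dpairC n c theta v : dpair (c%:MP_[n]) theta v = 0.
Proof. by rewrite /dpair big1 // => i _; rewrite mderivC rmorph0 mul0r. Qed.

Lemma dpairX n i theta v : @dpair n 'X_i theta v = v i.
Proof.
rewrite /dpair (bigD1 i) //= mderivX mnm1E eqxx scale1r.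
rewrite (_ : _ - _ = 0)%MM; last by apply/mnmP => j; rewrite mnmBE mnm0E subnn.
rewrite mpolyX0 rmorph1 mul1r big1 ?addr0 // => j ne.
by rewrite mderivX mnm1E eq_sym (negPf ne) scale0r rmorph0 mul0r.
Qed.

Lemma dpair_comp n m (P : {mpoly F[m]}) (y : 'I_m -> {mpoly F[n]}) theta v :
  dpair (mmap (@mpolyC n F) y P) theta v =
  dpair P (fun j => mmap iota theta (y j)) (fun j => dpair (y j) theta v).
Proof.
elim/mpoly_generators_ind: P => [c|i|P Q EP EQ|P Q EP EQ].
- by rewrite mmapC !dpairC.
- by rewrite mmapXU dpairX.
- by rewrite rmorphD /= !dpairD EP EQ.
- by rewrite rmorphM /= !dpairM EP EQ !mmap_mmap.
Qed.

End Differentials.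

Section TangentLift.
Variables (F : fieldType) (K : fieldType) (iota : {rmorphism F -> K}).

(** Chain rule: a derivation that is trivial on the constants gives a tangent
    vector, whose coordinates are its values at the coordinates of [theta]. *)
Lemma derivation_mmap L D n (theta : 'I_n -> K) : is_subring L -> is_derivation L D ->
    (forall c, L (iota c) /\ D (iota c) = 0) -> (forall i, L (theta i)) ->
  forall f, L (mmap iota theta f) /\
    D (mmap iota theta f) = dpair iota f theta (fun i => D (theta i)).
Proof.
move=> sL dD Lc Lt; elim/mpoly_generators_ind => [c|i|f g [Lf Ef] [Lg Eg]|f g [Lf Ef] [Lg Eg]].
- by rewrite mmapC dpairC; exact: Lc.
- by rewrite mmapXU dpairX.
- rewrite rmorphD dpairD -Ef -Eg /=.
  by split; [exact: subringD|exact: (derD sL dD)].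
- rewrite rmorphM dpairM -Ef -Eg /=.
  by split; [exact: subringM|exact: (derM dD)].
Qed.

(** The map given by [g] is submersive at generic points: a tangent vector at the
    image is a derivation of the subring generated by the coordinates of the
    image, and derivations extend along field extensions in characteristic
    zero. *)
Lemma generic_tangent_lift N m (theta : 'I_N -> K) (g : 'I_m -> {mpoly F[N]})
    (v : 'I_m -> K) : [pchar K] =i pred0 ->
    generic_tangent iota (fun j => mmap iota theta (g j)) v ->
  exists w, generic_tangent iota theta w /\ forall j, v j = dpair iota (g j) theta w.
Proof.
move=> ch0 Tv; set y := fun j => _ in Tv.
pose L : set K := [set z | exists f, mmap iota y f = z].
have sL : is_subring L.
  split; first by exists 1; rewrite rmorph1.
    by move=> _ _ [f <-] [h <-]; exists (f - h); rewrite rmorphB.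
  by move=> _ _ [f <-] [h <-]; exists (f * h); rewrite rmorphM.
pose D z := if pselect (L z) is left H then dpair iota (projT1 (cid H)) y v else 0.
have DE f : D (mmap iota y f) = dpair iota f y v.
  rewrite /D; case: pselect => [H|[]]; last by exists f.
  case: cid => h /= Eh; apply/eqP; rewrite -subr_eq0 -dpairB; apply/eqP/Tv.
  by rewrite rmorphB /= Eh subrr.
have dD : is_derivation L D.
  split=> _ _ [f <-] [h <-]; first by rewrite -rmorphB /= !DE dpairB.
  by rewrite -rmorphM /= !DE dpairM.
have [L' [D' [sL' LL' sL's dD' E']]] :=
  derivation_adjoin_seq (codom theta) ch0 sL dD.
have Lc c : L (iota c) by exists c%:MP; rewrite mmapC.
have Lc' c : L' (iota c) /\ D' (iota c) = 0.
  split; first by apply: LL'; exact: Lc.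
  by rewrite E' // -(mmapC y iota c) DE dpairC.
have Lt i : L' (theta i) by apply: sL's; exact: codom_f.
have H f := derivation_mmap sL' dD' Lc' Lt f.
exists (fun i => D' (theta i)); split.
  move=> f f0; have [_ <-] := H f; rewrite f0; exact: (der0 sL' dD').
move=> j; have [_ <-] := H (g j); have Ly : L (y j) by exists 'X_j; rewrite mmapXU.
by rewrite -/(y j) E' // -(mmapXU iota y j) DE dpairX.
Qed.

End TangentLift.

Section Jacobian.
Variable F : fieldType.

Definition jacobian c n (f : 'I_c -> {mpoly F[n]}) : 'M[{mpoly F[n]}]_(c, n) :=
  \matrix_(i, j) (f i)^`M(j).

Lemma row_free_colsub (K : fieldType) c n (J : 'M[K]_(c, n)) : row_free J ->
  exists g : 'I_c -> 'I_n, \det (colsub g J) != 0.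
Proof.
rewrite /row_free -mxrank_tr => fJ.
exists (fullrankfun (fJ : row_full J^T)); rewrite -unitfE -unitmxE -unitmx_tr.
rewrite (_ : _^T = rowsub (fullrankfun (fJ : row_full J^T)) J^T).
  exact: fullrowsub_unit.
by apply/matrixP => i j; rewrite !mxE.
Qed.

Lemma colsub_row_free (K : fieldType) c n (J : 'M[K]_(c, n)) (g : 'I_c -> 'I_n) :
  \det (colsub g J) != 0 -> row_free J.
Proof.
rewrite -unitfE -unitmxE => uJ; apply/row_freeP.
exists (colsub g 1%:M *m invmx (colsub g J)).
by rewrite mulmxA mulmx_colsub mulmx1 mulmxV.
Qed.

Lemma det_colsub_mmap (K : fieldType) (iota : {rmorphism F -> K}) c n m
    (J : 'M[{mpoly F[m]}]_(c, n)) (g : 'I_c -> 'I_n) (theta : 'I_m -> K) :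
  mmap iota theta (\det (colsub g J)) = \det (colsub g (map_mx (mmap iota theta) J)).
Proof. by rewrite -det_map_mx; congr (\det _); apply/matrixP => i j; rewrite !mxE. Qed.

End Jacobian.

Section Chains.
Variables (F : closedFieldType) (n : nat).
Hypothesis ch0 : [pchar F] =i pred0.
Local Notation V := 'rV[F]_n.
Implicit Types (A X : set V).

Definition algebraically_independent A e (y : 'I_e -> {mpoly F[n]}) : Prop :=
  forall P : {mpoly F[e]}, vanishing_ideal A (mmap (@mpolyC n F) y P) -> P = 0.

(** Choose [y k] vanishing on [Z k] but not on [Z k.+1]. A relation between
    [y 0, ..., y k] on [Z k.+1] may be divided by [y k] until its value at
    [y k = 0] is a nontrivial relation between the previous functions on [Z k]. *)
Lemma chain_independent A x e : has_chain_at A x e ->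
  exists y : 'I_e -> {mpoly F[n]}, algebraically_independent A y.
Proof.
move=> [Z [irr lt _ ZA]].
have Hy k : exists f, (k < e)%N -> vanishing_ideal (Z k) f /\ ~ vanishing_ideal (Z k.+1) f.
  have [ke|] := boolP (k < e)%N; last by exists 0.
  have [cZ _ _] := irr k (ltnW ke).
  by have [f [? ? _]] := separating_lead cZ (lt k ke); exists f.
have [y Py] := choice Hy.
exists (fun i => y i) => P /(vanishing_idealS ZA).
suff H k : (k <= e)%N -> forall P : {mpoly F[k]},
    vanishing_ideal (Z k) (mmap (@mpolyC n F) (fun i : 'I_k => y i) P) -> P = 0.
  exact: (H e (leqnn e)).
elim: k => [|k IH] ke {}P.
  rewrite (nvar0_mpolyC P) mmapC => H; have [_ [z Zz] _] := irr 0%N ke.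
  by have := H z Zz; rewrite mevalC => ->; rewrite mpolyC0.
have [yk nyk] := Py k ke; have [Z0 primeZ] := irreducible_prime (irr _ ke).
rewrite (mmap_muni (@mpolyC n F)) /=.
set ev := mmap _ _; rewrite -/(y k) => HP.
have Eev : ev = mmap (@mpolyC n F) (fun i : 'I_k => y i) by [].
apply/eqP/negPn/negP => P0.
have mP0 : muni P != 0 by apply: contra_neq P0; exact: muni_inj0.
(* [q] is the relation divided by the largest power of the last variable *)
have [a [q rq Eq]] := multiplicity_XsubC (muni P) 0.
move: rq; rewrite mP0 /= rootE => /eqP; apply.
have Hq : vanishing_ideal (Z k.+1) (map_poly ev q).[y k].
  move: HP; rewrite Eq polyC0 subr0 rmorphM /= rmorphXn /= map_polyX hornerM.
  rewrite hornerXn => /primeZ[//|]; elim: a {Eq} => [|a IHa].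
    rewrite expr0 => H1; have [z Zz] := Z0; have := H1 z Zz.
    by rewrite meval1 => /eqP; rewrite oner_eq0.
  by rewrite exprS => /primeZ[/nyk|].
apply: IH; first exact: ltnW.
rewrite -Eev; have [q' Eq'] : exists q', q = q' * 'X + (q.[0])%:P.
  have : root (q - (q.[0])%:P) 0 by rewrite rootE hornerD hornerN hornerC subrr.
  have E0 : 'X - 0%:P = 'X :> {poly {mpoly F[k]}} by rewrite polyC0 subr0.
  by case/factor_theorem => q'; rewrite E0 => E; exists q'; rewrite -E subrK.
have : vanishing_ideal (Z k) (map_poly ev q).[y k].
  by apply: vanishing_idealS Hq; exact: (lt k ke).1.
rewrite {1}Eq' rmorphD rmorphM /= map_polyX map_polyC hornerD hornerM hornerX hornerC /=.
move=> H; rewrite -[ev _](addKr ((map_poly ev q').[y k] * y k)).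
rewrite addrC; apply: vanishing_idealB => //.
by apply: vanishing_idealM.
Qed.

Lemma pchar_ext (K : fieldType) (iota : {rmorphism F -> K}) : [pchar K] =i pred0.
Proof. by move=> p; rewrite (fmorph_pchar iota) ch0. Qed.

(** Minors are polynomials, and a polynomial vanishes at the generic point only
    if it vanishes on [A]: the rank at the generic point is the largest one. *)
Lemma generic_row_free A (K : fieldType) (iota : {rmorphism F -> K}) (eta : 'rV[K]_n) c m
    (J : 'M[{mpoly F[n]}]_(c, m)) : is_generic_point A iota eta ->
  row_free (map_mx (mmap iota (eta ord0)) J) <->
  exists2 x, A x & row_free (map_mx (meval (x ord0)) J).
Proof.
move=> gen; split=> [/row_free_colsub[g]|[x Ax /row_free_colsub[g]]].
  rewrite -det_colsub_mmap => Hg.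
  have /existsNP[x /not_implyP[Ax /eqP Hx]] : ~ vanishing_ideal A (\det (colsub g J)).
    by move/gen/eqP; rewrite (negPf Hg).
  by exists x => //; apply: (colsub_row_free (g := g)); rewrite -(det_colsub_mmap idfun).
rewrite -(det_colsub_mmap idfun) => Hg; apply: (colsub_row_free (g := g)).
rewrite -det_colsub_mmap; apply: contra_neq Hg => /gen; exact.
Qed.

(** At the generic point of their image the functions [y] satisfy no relation, so
    all coordinate vectors are tangent there; lift them. *)
Lemma generic_tangent_rows A (K : fieldType) (iota : {rmorphism F -> K}) (eta : 'rV[K]_n)
    e (y : 'I_e -> {mpoly F[n]}) :
    is_generic_point A iota eta -> algebraically_independent A y ->
  exists2 W : 'M[K]_(e, n), row_free W &
    forall k, generic_tangent iota (eta ord0) (row k W ord0).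
Proof.
move=> gen indy.
have Hlift (k : 'I_e) : exists w, generic_tangent iota (eta ord0) w /\
    forall j, (j == k)%:R = dpair iota (y j) (eta ord0) w.
  apply: (generic_tangent_lift (v := fun j => (j == k)%:R)).
    exact: pchar_ext.
  move=> P; rewrite mmap_mmap => /gen/indy ->.
  by rewrite -mpolyC0 dpairC.
have [W HW] := choice Hlift.
exists (\matrix_(k, i) W k i); last first.
  move=> k f /(HW k).1 f0; rewrite -[RHS]f0; apply: eq_bigr => i _.
  by rewrite !mxE.
apply/row_freeP; exists (\matrix_(i, j) mmap iota (eta ord0) (y j)^`M(i)).
apply/matrixP => k j; rewrite !mxE eq_sym (HW k).2; apply: eq_bigr => i _.
by rewrite !mxE mulrC.
Qed.

Lemma tangent_rows_sub A (K : fieldType) (iota : {rmorphism F -> K}) (eta : 'rV[K]_n)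
    e (W : 'M[K]_(e, n)) c (f : 'I_c -> {mpoly F[n]}) :
    is_generic_point A iota eta -> (forall i, vanishing_ideal A (f i)) ->
    (forall k, generic_tangent iota (eta ord0) (row k W ord0)) ->
  (W <= kermx (map_mx (mmap iota (eta ord0)) (jacobian f))^T)%MS.
Proof.
move=> gen Af HW; apply/sub_kermxP/matrixP => k j; rewrite !mxE.
rewrite -[RHS](HW k (f j) ((gen _).2 (Af j))); apply: eq_bigr => i _.
by rewrite !mxE mulrC.
Qed.

(** The rank of the Jacobian can only increase at the generic point, and there
    it kills the [e] independent tangent vectors that lift the coordinate
    vectors of [y]. *)
Lemma jacobian_rank_bound A e (y : 'I_e -> {mpoly F[n]}) c
    (f : 'I_c -> {mpoly F[n]}) (x : V) :
    prime_vanishing A -> algebraically_independent A y ->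
    (forall i, vanishing_ideal A (f i)) -> A x ->
    row_free (map_mx (meval (x ord0)) (jacobian f)) ->
  (c + e <= n)%N.
Proof.
move=> pA indy Af Ax Jx.
have [K [iota [eta [gen _]]]] := exists_generic_point pA.
have Jfree : row_free (map_mx (mmap iota (eta ord0)) (jacobian f)).
  by apply/(generic_row_free _ gen); exists x.
have [W Wfree HW] := generic_tangent_rows gen indy.
have := mxrankS (tangent_rows_sub gen Af HW); rewrite mxrank_ker mxrank_tr.
have cn : (c <= n)%N by have /eqP <- := Jfree; exact: rank_leq_col.
move: Wfree Jfree; rewrite /row_free => /eqP -> /eqP -> => le.
by rewrite -(subnKC cn) leq_add2l.
Qed.

End Chains.

(** * Chains of irreducible closed sets through general points *)

Section GeneralPoints.
Variables (F : closedFieldType) (n : nat).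
Local Notation V := 'rV[F]_n.
Implicit Types (A X : set V).

Lemma spec_mmap (K : fieldType) (iota : {rmorphism F -> K}) L phi m (theta : 'I_m -> K) :
    is_subring L -> is_specialization L phi -> (forall c, L (iota c) /\ phi (iota c) = c) ->
    (forall i, L (theta i)) ->
  forall f, L (mmap iota theta f) /\ phi (mmap iota theta f) = f.@[fun i => phi (theta i)].
Proof.
move=> sL pphi Lc Lt; elim/mpoly_generators_ind => [c|i|f g [Lf Ef] [Lg Eg]|f g [Lf Ef] [Lg Eg]].
- by rewrite mmapC mevalC; exact: Lc.
- by rewrite mmapXU mevalXU.
- rewrite rmorphD mevalD -Ef -Eg /=.
  by split; [exact: subringD|exact: (specD sL pphi)].
- rewrite rmorphM mevalM -Ef -Eg /=.
  by split; [exact: subringM|exact: (specM pphi)].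
Qed.

(** Prescribing the values [c] of [y] is a homomorphism from the ring generated by
    the functions [y]; it extends to the coordinates of the generic point as
    soon as a nonzero [H] survives, and the values of these coordinates are the
    desired point. *)
Lemma independent_values A d (y : 'I_d -> {mpoly F[n]}) h :
    zariski_closed A -> prime_vanishing A -> algebraically_independent A y ->
    ~ vanishing_ideal A h ->
  exists2 H : {mpoly F[d]}, H != 0 & forall c : 'I_d -> F, H.@[c] != 0 ->
    exists x, [/\ A x, forall j, (y j).@[x ord0] = c j & h.@[x ord0] != 0].
Proof.
move=> cA pA indy nh; have [K [iota [eta [gen _]]]] := exists_generic_point pA.
set ev := mmap iota (eta ord0) in gen.
pose yh j := ev (y j).
pose L : set K := [set z | exists f, mmap iota yh f = z].
have sL : is_subring L.
  split; first by exists 1; rewrite rmorph1.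
    by move=> _ _ [f <-] [g <-]; exists (f - g); rewrite rmorphB.
  by move=> _ _ [f <-] [g <-]; exists (f * g); rewrite rmorphM.
have injy P : mmap iota yh P = 0 -> P = 0.
  by rewrite /yh mmap_mmap => /gen/indy.
pose s := codom (eta ord0); pose L' := foldl (@adjoin K) L s.
have sL' : is_subring L' by exact: foldl_adjoin_subring.
have LL' : L `<=` L' by exact: foldl_adjoin_sub.
have Lc c : L (iota c) by exists c%:MP; rewrite mmapC.
have Lt i : L' (eta ord0 i) by apply: foldl_adjoin_mem => //; exact: codom_f.
have Lev f : L' (ev f).
  rewrite /ev; elim/mpoly_generators_ind: f => [c|i|f g Lf Lg|f g Lf Lg].
  - by rewrite mmapC; apply: LL'; exact: Lc.
  - by rewrite mmapXU; exact: Lt.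
  - by rewrite rmorphD; exact: subringD.
  - by rewrite rmorphM; exact: subringM.
have h0 : ev h != 0 by apply: contra_not_neq nh => /gen.
have [_ [[H <-] H0 ext]] := spec_adjoin_seq F sL (Lev h) h0.
exists H; first by apply: contra_neq H0 => ->; rewrite rmorph0.
move=> c Hc.
pose phi z : F := if pselect (L z) is left Lz then (projT1 (cid Lz)).@[c] else 0.
have phiE P : phi (mmap iota yh P) = P.@[c].
  rewrite /phi; case: pselect => [Lz|[]]; last by exists P.
  case: cid => Q /= EQ; apply/eqP; rewrite -subr_eq0 -mevalB (injy (Q - P)) ?meval0 //.
  by rewrite rmorphB /= EQ subrr.
have pphi : is_specialization L phi.
  split; first by rewrite -(rmorph1 (mmap iota yh)) phiE meval1.
    by move=> _ _ [f <-] [g <-]; rewrite -rmorphB /= !phiE mevalB.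
  by move=> _ _ [f <-] [g <-]; rewrite -rmorphM /= !phiE mevalM.
have [|phi' [pphi' E' h'0]] := ext phi pphi; first by rewrite phiE.
have Lc' a : L' (iota a) /\ phi' (iota a) = a.
  split; first (by apply: LL'; exact: Lc).
  by rewrite E' // -(mmapC yh iota a) phiE mevalC.
have phiev f : phi' (ev f) = f.@[fun i => phi' (eta ord0 i)].
  by have [_ ->] := spec_mmap sL' pphi' Lc' Lt f.
pose x : V := \row_i phi' (eta ord0 i).
have xE f : f.@[x ord0] = phi' (ev f) by rewrite phiev; apply: eq_mmap => // i; rewrite mxE.
exists x; split; last by rewrite xE.
  have /zariski_closedP -> := cA => f /gen f0; rewrite xE /ev f0.
  exact: (spec0 sL' pphi').
move=> j; have E : ev (y j) = mmap iota yh 'X_j by rewrite mmapXU.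
by rewrite xE E E' ?phiE ?mevalXU //; exists 'X_j.
Qed.

(** Cut [A] by a hypersurface on which the last function is constant, for a
    general constant: some component of the section is not contained in the
    zeros of [h] and keeps the other functions independent. *)
Lemma chain_through A d (y : 'I_d -> {mpoly F[n]}) h :
    irreducible_closed (@zariski_closed F n) A -> algebraically_independent A y ->
    ~ vanishing_ideal A h ->
  exists x, [/\ A x, h.@[x ord0] != 0 & has_chain_at A x d].
Proof.
elim: d A y => [|d IH] A y irrA indy nh.
  move/existsNP: (nh) => [x /not_implyP[Ax /eqP hx]]; exists x; split=> //.
  by exists (fun=> A); split.
have [cA A0 _] := irrA; have pA := irreducible_prime irrA.
have [H H0 HH] := independent_values cA pA indy nh.
have [c Hc] := mpoly_nonroot H0.
pose w := widen_ord (leqnSn d); pose cm := c ord_max.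
pose u := y ord_max - cm%:MP.
have nu : ~ vanishing_ideal A u.
  move=> Au; have : 'X_ord_max - cm%:MP = 0 :> {mpoly F[d.+1]}.
    by apply: indy; rewrite rmorphB /= mmapXU mmapC.
  move/(congr1 (meval (fun=> cm + 1))); rewrite mevalB mevalXU mevalC meval0 addrC addKr.
  by move/eqP; rewrite oner_eq0.
pose A' := A `&` [set x | u.@[x ord0] = 0].
have cA' : zariski_closed A' by apply: zariski_closedI => //; exact: closed_zero.
have [s [irrs Es]] := irreducible_decomposition cA'.
have [k [ks nhk indk]] : exists k, [/\ (k < size s)%N, ~ vanishing_ideal (nth set0 s k) h &
    algebraically_independent (nth set0 s k) (fun j => y (w j))].
  apply: contrapT => Hno.
  (* otherwise each component carries a relation, valid where [h] is nonzero *)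
  have HP (k : nat) : exists P : {mpoly F[d]}, P != 0 /\ ((k < size s)%N ->
      forall x, nth set0 s k x -> h.@[x ord0] != 0 ->
      P.@[fun j => (y (w j)).@[x ord0]] = 0).
    have [ks|ks] := boolP (k < size s)%N; last by exists 1; rewrite oner_neq0.
    have [hk|hk] := pselect (vanishing_ideal (nth set0 s k) h).
      by exists 1; rewrite oner_neq0; split=> // _ x /hk ->; rewrite eqxx.
    have : ~ algebraically_independent (nth set0 s k) (fun j => y (w j)).
      by move=> indk; apply: Hno; exists k.
    move/existsNP => [P /not_implyP[PA /eqP P0]]; exists P; split=> // _ x /PA + _.
    by rewrite mmap_polyC_eval.
  have [P HP'] := choice HP.
  pose H1 : {mpoly F[d]} := mmap (@mpolyC d F)
    (fun i : 'I_d.+1 => if insub (val i) is Some j then 'X_j else cm%:MP) H.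
  have H1E b : H1.@[b] = H.@[fun i : 'I_d.+1 => if insub (val i) is Some j then b j else cm].
    rewrite /H1 /meval -(mmap_mmap idfun).
    apply: eq_mmap => // i; case: insubP => [j _ _|_]; first by rewrite mmapXU.
    by rewrite mmapC.
  have H10 : H1 != 0.
    apply: contra_neq Hc => E; have := H1E (fun j => c (w j)); rewrite E meval0 => ->.
    apply: eq_mmap => // i; case: insubP => [j lt Ej|]; first by congr c; apply: val_inj.
    rewrite -leqNgt => le; congr c; apply/val_inj/eqP => /=.
    by rewrite eqn_leq le -ltnS ltn_ord.
  (* the point of the slice over values [b] that avoid all these relations *)
  have : H1 * \prod_(k <- iota 0 (size s)) P k != 0.
    rewrite mulf_neq0 // prodf_seq_neq0; apply/allP => k _; exact: (HP' k).1.
  move=> /mpoly_nonroot[b]; rewrite mevalM mulf_eq0 negb_or => /andP[H1b Pb].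
  have [|x [Ax yx hx]] := HH (fun i => if insub (val i) is Some j then b j else cm).
    by rewrite -H1E.
  have A'x : A' x.
    split=> //=; rewrite mevalB mevalC yx insubF ?subrr //.
    by rewrite /= ltnn.
  have [k ks kx] := (Es x).1 A'x.
  move: Pb; rewrite rmorph_prod /= prodf_seq_neq0 => /allP /(_ k).
  rewrite mem_iota /= add0n ks => /(_ isT)/=.
  rewrite -((HP' k).2 ks x kx hx); apply/negP; rewrite negbK; apply/eqP.
  apply: eq_mmap => // j; rewrite yx insubT //= => lt.
  by congr b; apply: val_inj.
have [x [Zx hx [Z [irrZ ltZ Z0 Zd]]]] := IH _ _ (irrs k ks) indk nhk.
have subA' : nth set0 s k `<=` A' by move=> z kz; apply/Es; exists k.
exists x; split=> //; first by have [] := subA' _ Zx.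
exists (fun k => if (k <= d)%N then Z k else A); split=> //.
- by move=> j _; case: ifP => // /irrZ.
- move=> j; rewrite ltnS => jd; rewrite jd; case: ltnP => [lt|ge]; first exact: ltZ.
  have -> : j = d by apply/eqP; rewrite eqn_leq jd.
  split=> [z /Zd/subA'[]//|AZ]; apply: nu => z Az.
  by have [] := subA' _ (Zd _ (AZ _ Az)).
- by rewrite ltnn.
Qed.

End GeneralPoints.

(** * Conormal frames and the density of the smooth locus *)

Section LinearAlgebra.
Variable K : fieldType.

Lemma orthogonal_sub c n (J : 'M[K]_(c, n)) (u : 'rV[K]_n) :
    (forall v : 'rV[K]_n, v *m J^T = 0 -> u *m v^T = 0) -> (u <= J)%MS.
Proof.
move=> H; rewrite submxE; apply/eqP/trmx_inj; rewrite trmx0 trmx_mul.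
apply/row_matrixP => i; rewrite row0 row_mul; apply: trmx_inj.
rewrite trmx0 trmx_mul trmxK; apply: H; rewrite -row_mul -trmx_mul mulmx_coker.
by rewrite trmx0 row0.
Qed.

Lemma dim_kernel c n (J : 'M[K]_(c, n)) (T : {vspace 'rV[K]_n}) : row_free J ->
  (forall v, (v \in T) = (v *m J^T == 0)) -> (\dim T = n - c)%N.
Proof.
move=> /row_freeP[B JB] HT; pose f := linfun (mulmxr J^T : 'rV[K]_n -> 'rV[K]_c).
have -> : T = lker f by apply/vspaceP => v; rewrite HT memv_ker lfunE.
have limgf : limg f = fullv.
  apply/vspaceP => w; rewrite memvf; apply/memv_imgP; exists (w *m B^T); first exact: memvf.
  by rewrite lfunE /= -mulmxA -trmx_mul JB trmx1 mulmx1.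
have := limg_ker_dim f fullv; rewrite limgf capfv !dimvf /dim /= !mul1n => En.
by rewrite -[X in (X - _)%N]En addnK.
Qed.

Lemma exists_kernel c n (J : 'M[K]_(c, n)) :
  exists T : {vspace 'rV[K]_n}, forall v, (v \in T) = (v *m J^T == 0).
Proof.
by exists (lker (linfun (mulmxr J^T : 'rV[K]_n -> 'rV[K]_c))) => v; rewrite memv_ker lfunE.
Qed.

Lemma kernel_sub_rows d c n (W : 'M[K]_(d, n)) (J : 'M[K]_(c, n)) :
    row_free W -> row_free J -> (d = n - c)%N -> (W <= kermx J^T)%MS ->
  forall v : 'rV[K]_n, v *m J^T = 0 -> (v <= W)%MS.
Proof.
move=> /eqP Wfree /eqP Jfree Ed WJ v /sub_kermxP/submx_trans; apply.
have [_] := mxrank_leqif_sup WJ.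
by rewrite mxrank_ker mxrank_tr Wfree Jfree -Ed eqxx => <-.
Qed.

Lemma row_free_col_mx c n (J : 'M[K]_(c, n)) (u : 'rV[K]_n) :
  row_free (col_mx J u) <-> row_free J /\ ~ (u <= J)%MS.
Proof.
split=> [free|[free nu]].
  split.
    apply: inj_row_free => v Jv; have E : row_mx v 0 *m col_mx J u = 0.
      by rewrite mul_row_col Jv mul0mx addr0.
    by have := row_free_inj free (etrans E (esym (mul0mx _ _))) => /(congr1 lsubmx);
      rewrite row_mxKl linear0.
  move=> /submxP[v Ev]; have E : row_mx v (- 1%:M) *m col_mx J u = 0.
    by rewrite mul_row_col -Ev mulNmx mul1mx subrr.
  have := row_free_inj free (etrans E (esym (mul0mx _ _))) => /(congr1 rsubmx).
  rewrite row_mxKr linear0 => /matrixP/(_ 0 0); rewrite !mxE eqxx => /eqP.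
  by rewrite oppr_eq0 oner_eq0.
apply: inj_row_free => v.
rewrite -[v]hsubmxK mul_row_col; set v1 := lsubmx v; set v2 := rsubmx v => E.
have v20 : v2 = 0.
  apply/eqP; apply: contra_notT nu => nv2; have Ev2 := mx11_scalar v2.
  have a0 : v2 0 0 != 0 by apply: contra_neq nv2 => a0; rewrite Ev2 a0 raddf0.
  have : (v2 *m u <= J)%MS.
    move/eqP: E; rewrite addrC addr_eq0 => /eqP ->.
    by rewrite -mulNmx submxMl.
  by rewrite Ev2 mul_scalar_mx (eqmx_scale _ a0).
have v10 : v1 = 0.
  by apply: (row_free_inj free); rewrite mul0mx -[RHS]E v20 mul0mx addr0.
by rewrite v10 v20 row_mx0.
Qed.

End LinearAlgebra.

Section MaximalJacobian.
Variables (F K : fieldType) (iota : {rmorphism F -> K}) (n : nat) (theta : 'I_n -> K).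

Definition jacobian_at c (f : 'I_c -> {mpoly F[n]}) : 'M[K]_(c, n) :=
  map_mx (mmap iota theta) (jacobian f).

Lemma dpair_mulmx (f : {mpoly F[n]}) (v : 'rV[K]_n) :
  dpair iota f theta (v ord0) = (differential iota f theta *m v^T) 0 0.
Proof. by rewrite mxE; apply: eq_bigr => i _; rewrite !mxE. Qed.

Lemma jacobian_mulmx c (f : 'I_c -> {mpoly F[n]}) (v : 'rV[K]_n) :
  v *m (jacobian_at f)^T = 0 <-> forall i, dpair iota (f i) theta (v ord0) = 0.
Proof.
have E i : dpair iota (f i) theta (v ord0) = (v *m (jacobian_at f)^T) 0 i.
  by rewrite mxE; apply: eq_bigr => j _; rewrite !mxE mulrC.
split=> [v0 i|H]; first by rewrite E v0 mxE.
by apply/rowP => i; rewrite -E H mxE.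
Qed.

Lemma maximal_jacobian (I : set {mpoly F[n]}) :
  exists c (f : 'I_c -> {mpoly F[n]}), [/\ forall i, I (f i), row_free (jacobian_at f) &
    forall g, I g -> (differential iota g theta <= jacobian_at f)%MS].
Proof.
pose Q (c : nat) := `[< exists f : 'I_c -> {mpoly F[n]},
  (forall i, I (f i)) /\ row_free (jacobian_at f) >].
have Q0 : exists c, Q c.
  exists 0%N; apply/asboolP; exists (fun=> 0); split=> [[]//|].
  by rewrite /row_free -leqn0 rank_leq_row.
have Qn c : Q c -> (c <= n)%N.
  by move=> /asboolP[f [_ /eqP <-]]; exact: rank_leq_col.
case: (ex_maxnP Q0 Qn) => c /asboolP[f [If ffree]] maxc.
exists c, f; split=> // g Ig; apply/negPn/negP => /negP ng.
suff : Q (c + 1)%N by move/maxc; rewrite addn1 ltnn.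
apply/asboolP; exists (fun i => match split i with inl j => f j | inr _ => g end).
split=> [i|]; first by case: (split i).
set J := jacobian_at _; have -> : J = col_mx (jacobian_at f) (differential iota g theta).
  apply/matrixP => i j; rewrite !mxE; case: (split i) => k; rewrite !mxE //.
by apply/row_free_col_mx; split.
Qed.

End MaximalJacobian.

Section SmoothLocus.
Variables (F : closedFieldType) (n : nat).
Hypothesis ch0 : [pchar F] =i pred0.
Local Notation V := 'rV[F]_n.
Local Notation jac x f := (jacobian_at idfun (x ord0) f).
Local Notation diff f x := (differential idfun f (x ord0)).
Implicit Types (A X : set V) (x v : V).

(** Equations of [A] whose differentials at [x] are a basis of the conormal
    space of [A] at [x]. *)
Definition conormal_frame A x c (f : 'I_c -> {mpoly F[n]}) : Prop :=
  [/\ forall i, vanishing_ideal A (f i), row_free (jac x f) &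
      forall g, vanishing_ideal A g -> (diff g x <= jac x f)%MS].

Lemma exists_conormal_frame A x : exists c (f : 'I_c -> {mpoly F[n]}), conormal_frame A x f.
Proof.
by have [c [f H]] := maximal_jacobian idfun (x ord0) (vanishing_ideal A); exists c, f.
Qed.

Lemma tangent_space_frame A x c (f : 'I_c -> {mpoly F[n]}) v : conormal_frame A x f ->
  variety_tangent_space A x v <-> v *m (jac x f)^T = 0.
Proof.
move=> [Af _ maxf]; split=> [Tv|]; first by apply/jacobian_mulmx => i; exact: Tv.
move=> Jv g Ag; have -> : \sum_(i < n) (g^`M(i)).@[x ord0] * v ord0 i
  = dpair idfun g (x ord0) (v ord0) by [].
have /submxP[u Eu] := maxf g Ag; rewrite dpair_mulmx Eu -mulmxA.
by rewrite -[jac x f]trmxK -trmx_mul Jv trmx0 mulmx0 mxE.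
Qed.

Lemma pairingE (xi v : V) : pairing xi v = (xi *m v^T) 0 0.
Proof. by rewrite mxE; apply: eq_bigr => i _; rewrite !mxE. Qed.

Lemma conormal_sub_frame A x c (f : 'I_c -> {mpoly F[n]}) (xi : V) :
  conormal_frame A x f ->
  annihilator (variety_tangent_space A x) xi -> (xi <= jac x f)%MS.
Proof.
move=> Hf H; apply: orthogonal_sub => v /(tangent_space_frame v Hf)/H; rewrite pairingE => E.
by apply/matrixP => i j; rewrite !ord1 E mxE.
Qed.

Lemma differential_sum c (f : 'I_c -> {mpoly F[n]}) (u : 'rV[F]_c) x :
  diff (\sum_i u 0 i *: f i) x = u *m jac x f.
Proof.
apply/rowP => j; rewrite !mxE (raddf_sum (mderiv j)) (raddf_sum (mmap idfun _)) /=.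
by apply: eq_bigr => i _; rewrite !mxE mderivZ mmapZ.
Qed.

(** Conormal covectors are differentials of single equations, since ideals are
    closed under linear combinations. *)
Lemma conormal_differential A x (xi : V) :
    annihilator (variety_tangent_space A x) xi ->
  exists2 G, vanishing_ideal A G & xi = diff G x.
Proof.
have [c [f Hf]] := exists_conormal_frame A x => /(conormal_sub_frame Hf)/submxP[u ->].
exists (\sum_i u 0 i *: f i); last by rewrite differential_sum.
apply: (big_ind (vanishing_ideal A)); first exact: vanishing_ideal0.
  by move=> *; exact: vanishing_idealD.
by move=> i _; rewrite -mul_mpolyC; apply: vanishing_idealM; case: Hf.
Qed.

Lemma differential_conormal A x G : vanishing_ideal A G ->
  annihilator (variety_tangent_space A x) (diff G x).
Proof. by move=> AG v Tv; rewrite pairingE -dpair_mulmx; exact: Tv. Qed.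

Lemma frame_dim A x c (f : 'I_c -> {mpoly F[n]}) (T : {vspace V}) :
  conormal_frame A x f -> variety_tangent_space A x = [set v | v \in T] ->
  (\dim T = n - c)%N.
Proof.
move=> Hf ET; have [_ ffree _] := Hf; apply: (dim_kernel ffree) => v.
have E : (v \in T) <-> variety_tangent_space A x v by rewrite ET.
by apply/idP/eqP => [/E/(tangent_space_frame v Hf)|/(tangent_space_frame v Hf)/E].
Qed.

Lemma smooth_frame A x c (f : 'I_c -> {mpoly F[n]}) : conormal_frame A x f ->
  smooth_locus A x <-> A x /\ has_local_dim A x (n - c).
Proof.
move=> Hf; split=> [[Ax [T [ET]]]|[Ax dimA]]; first by rewrite (frame_dim Hf ET).
split=> //; have [T HT] := exists_kernel (jac x f); exists T.
have ET : variety_tangent_space A x = [set v | v \in T].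
  apply/seteqP; split=> v /=; rewrite HT; first by move/(tangent_space_frame v Hf)/eqP.
  by move/eqP/(tangent_space_frame v Hf).
by split=> //; rewrite (frame_dim Hf ET).
Qed.

Lemma row_free_le c (J : 'M[F]_(c, n)) : row_free J -> (c <= n)%N.
Proof. by move=> /eqP <-; exact: rank_leq_col. Qed.

(** Smoothness at [x] provides a chain of length [n - c], hence [n - c]
    independent functions on [A]; they bound the rank of Jacobians at all points
    of [A]. *)
Lemma smooth_frame_max A x c (f : 'I_c -> {mpoly F[n]}) x' c' (f' : 'I_c' -> {mpoly F[n]}) :
    prime_vanishing A -> smooth_locus A x -> conormal_frame A x f ->
    A x' -> (forall i, vanishing_ideal A (f' i)) -> row_free (jac x' f') ->
  (c' <= c)%N.
Proof.
move=> pA sx Hf Ax' Af' free'.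
have /(smooth_frame Hf)[Ax [chain _]] := sx.
have [y indy] := chain_independent chain.
have := jacobian_rank_bound ch0 pA indy Af' Ax' free'.
have [_ /row_free_le cn _] := Hf.
by rewrite addnC -{2}(subnK cn) leq_add2l.
Qed.

(** One more independent differential would give a system exceeding the maximal
    size of frames. *)
Lemma frame_persists A x c (f : 'I_c -> {mpoly F[n]}) x' :
    prime_vanishing A -> smooth_locus A x -> conormal_frame A x f ->
    A x' -> row_free (jac x' f) -> conormal_frame A x' f.
Proof.
move=> pA sx Hf Ax' free; have [Af _ _] := Hf; split=> // g Ag.
apply: contrapT => ng.
suff le : (c + 1 <= c)%N by move: le; rewrite addn1 ltnn.
apply: (@smooth_frame_max A x c f x' (c + 1)
  (fun i => match split i with inl j => f j | inr _ => g end) pA sx Hf Ax').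
  by move=> i; case: (split i).
set J := jacobian_at _ _ _; have -> : J = col_mx (jac x' f) (diff g x').
  by apply/matrixP => i j; rewrite !mxE; case: (split i) => k; rewrite !mxE.
exact/row_free_col_mx.
Qed.

(** The length of chains at the smooth point [x0] gives independent functions,
    hence chains of the same length through a dense set of points; those where
    a frame at [x0] stays independent are smooth, as their tangent spaces have
    that length as dimension. *)
Lemma smooth_locus_dense A x0 g : irreducible_closed (@zariski_closed F n) A ->
  smooth_locus A x0 -> (forall x, smooth_locus A x -> g.@[x ord0] = 0) ->
  vanishing_ideal A g.
Proof.
move=> irrA sx0 Hg; have pA := irreducible_prime irrA.
apply: contrapT => ng.
have [c [f Hf]] := exists_conormal_frame A x0; have [Af ffree _] := Hf.
have /(smooth_frame Hf)[Ax0 [chain0 _]] := sx0.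
have [y indy] := chain_independent chain0.
have [k Hk] := row_free_colsub ffree; rewrite -(det_colsub_mmap idfun) in Hk.
set det := \det _ in Hk.
have ndet : ~ vanishing_ideal A (g * det).
  by move/pA.2 => [//|/(_ _ Ax0) E]; move: Hk; rewrite -/(meval _ _) E eqxx.
have [x [Ax gdx chain]] := chain_through irrA indy ndet.
move: gdx; rewrite mevalM mulf_eq0 negb_or => /andP[gx detx].
have xfree : row_free (jac x f).
  by apply: (colsub_row_free (g := k)); rewrite -(det_colsub_mmap idfun).
have Hfx := frame_persists pA sx0 Hf Ax xfree.
have smx : smooth_locus A x.
  apply/(smooth_frame Hfx); split=> //; split=> // e /chain_independent[y' indy'].
  have le := jacobian_rank_bound ch0 pA indy' Af Ax xfree.
  by rewrite leq_subRL // (leq_trans _ le) // leq_addr.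
by move: gx; rewrite (Hg _ smx) eqxx.
Qed.

End SmoothLocus.

(** * The conormal variety is irreducible *)

Definition joint T m n (a : 'I_m -> T) (b : 'I_n -> T) (i : 'I_(m + n)) : T :=
  match split i with inl j => a j | inr j => b j end.

Lemma joint_lshift T m n (a : 'I_m -> T) (b : 'I_n -> T) i : joint a b (lshift n i) = a i.
Proof. by rewrite /joint (unsplitK (inl i)). Qed.

Lemma joint_rshift T m n (a : 'I_m -> T) (b : 'I_n -> T) i : joint a b (rshift m i) = b i.
Proof. by rewrite /joint (unsplitK (inr i)). Qed.

Lemma row_mx_joint T m n (a : 'rV[T]_m) (b : 'rV[T]_n) :
  row_mx a b ord0 =1 joint (a ord0) (b ord0).
Proof. by move=> i; rewrite mxE. Qed.

Section Conormal.
Variables (F : closedFieldType) (n : nat).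
Hypothesis ch0 : [pchar F] =i pred0.
Local Notation V := 'rV[F]_n.
Local Notation jac x f := (jacobian_at idfun (x ord0) f).
Local Notation diff f x := (differential idfun f (x ord0)).
Implicit Types (A X : set V) (x v xi : V) (z : 'rV[F]_(n + n)).

Lemma vanishing_closure m (A : set 'rV[F]_m) :
  vanishing_ideal (zariski_closure A) = vanishing_ideal A.
Proof.
apply/seteqP; split; last first.
  by move=> f Af x; rewrite zariski_closure_locus; apply.
apply: vanishing_idealS => x Ax B _; exact.
Qed.

Definition is_cone X : Prop := forall (t : F) x, X x -> X (t *: x).

(** Differentiate [G (t x) = 0] at [t = 1]. *)
Lemma euler_relation X G x : is_cone X -> vanishing_ideal X G -> X x ->
  dpair idfun G (x ord0) (x ord0) = 0.
Proof.
move=> coneX XG Xx.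
(* the coordinates of [t x], as polynomials in the single variable [t] *)
pose y i : {mpoly F[1]} := x ord0 i *: 'X_ord0.
have yE t i : (y i).@[t] = t ord0 * x ord0 i by rewrite mevalZ mevalXU mulrC.
have E0 : mmap (@mpolyC 1 F) y G = 0.
  apply/eqP/negPn/negP => /mpoly_nonroot[t]; rewrite mmap_polyC_eval => /eqP; apply.
  rewrite -(XG _ (coneX (t ord0) _ Xx)); apply: meval_eq => i.
  by rewrite yE mxE.
have := dpair_comp idfun G y (fun=> 1) (fun=> 1).
rewrite E0 -mpolyC0 dpairC => E; rewrite [RHS]E.
apply: eq_bigr => i _; congr (_ * _).
  by apply: eq_mmap => // j; rewrite -[RHS]/((y j).@[fun=> 1]) yE mul1r.
by rewrite /y -mul_mpolyC dpairM dpairC dpairX mmapC mul0r addr0 mulr1.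
Qed.

Lemma conormal_mem X x G : smooth_locus X x -> vanishing_ideal X G ->
  conormal_bundle X (row_mx x (diff G x)).
Proof. by move=> sx XG; split; rewrite ?row_mxKl ?row_mxKr //; exact: differential_conormal. Qed.

Lemma conormal_memP X z : conormal_bundle X z ->
  exists x G, [/\ smooth_locus X x, vanishing_ideal X G & z = row_mx x (diff G x)].
Proof.
move=> [sx /conormal_differential[G XG EG]]; exists (lsubmx z), G; split=> //.
by rewrite -EG hsubmxK.
Qed.

(** A conormal space contains with two differentials [dG1], [dG2] the line through
    them, and a product vanishing along a line has a factor that does. So at
    every smooth point [f] vanishes at [dG1] or [g] at [dG2]; density of the
    smooth locus turns this into a product in the prime ideal of [X]. *)
Lemma conormal_prime X : irreducible_closed (@zariski_closed F n) X ->
  conormal_bundle X !=set0 -> prime_vanishing (conormal_bundle X).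
Proof.
move=> irrX NX0; split=> // f g Hfg; have pX := irreducible_prime irrX.
have [Nf|/existsNP[z1 /not_implyP[Nz1 /eqP fz1]]] :=
  pselect (vanishing_ideal (conormal_bundle X) f); first by left.
right=> z2 Nz2; apply: contrapT => /eqP gz2.
have [x1 [G1 [sx1 XG1 E1]]] := conormal_memP Nz1.
have [x2 [G2 [sx2 XG2 E2]]] := conormal_memP Nz2.
pose sub (h : {mpoly F[n + n]}) (G : {mpoly F[n]}) : {mpoly F[n]} :=
  mmap (@mpolyC n F) (joint (fun j => 'X_j) (fun j => G^`M(j))) h.
have subE h G x : (sub h G).@[x ord0] = h.@[row_mx x (diff G x) ord0].
  rewrite mmap_polyC_eval; apply: meval_eq => i; rewrite row_mx_joint /joint.
  by case: (split i) => j; rewrite ?mevalXU ?mxE.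
have : vanishing_ideal X (sub f G1 * sub g G2).
  apply: (smooth_locus_dense ch0 irrX sx1) => x sx; rewrite mevalM !subE.
  pose line : 'I_(n + n) -> {poly F} := joint (fun j => (x ord0 j)%:P)
    (fun j => (diff G1 x ord0 j)%:P + 'X * (diff G2 x ord0 j - diff G1 x ord0 j)%:P).
  pose pl h := mmap (@polyC F) line h.
  have plE h t : (pl h).[t] =
      h.@[row_mx x (diff G1 x + t *: (diff G2 x - diff G1 x)) ord0].
    rewrite -[LHS]/(horner_eval t (pl h)) /pl /meval.
    elim/mpoly_generators_ind: h => [c|i|p q Ep Eq|p q Ep Eq].
    - by rewrite !mmapC /= /horner_eval hornerC.
    - rewrite !mmapXU row_mx_joint /horner_eval /line /joint; case: (split i) => j.
        by rewrite hornerC.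
      by rewrite !mxE !(hornerD, hornerM, hornerX, hornerC).
    - by rewrite !rmorphD /= Ep Eq.
    - by rewrite !rmorphM /= Ep Eq.
  have : pl f * pl g = 0.
    apply/eqP/negPn/negP => /exists_nonroot[t]; rewrite hornerM !plE -mevalM.
    rewrite Hfg ?eqxx //.
    have -> : diff G1 x + t *: (diff G2 x - diff G1 x) = diff (G1 + t *: (G2 - G1)) x.
      by apply/rowP => j; rewrite !mxE mderivD mderivZ mderivB rmorphD /= mmapZ rmorphB.
    apply: conormal_mem => //; apply: vanishing_idealD => //.
    by rewrite -mul_mpolyC; apply: vanishing_idealM; exact: vanishing_idealB.
  move/eqP; rewrite mulf_eq0 => /orP[/eqP E|/eqP E].
    by have := plE f 0; rewrite E horner0 scale0r addr0 => <-; rewrite mul0r.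
  by have := plE g 1; rewrite E horner0 scale1r addrC subrK => <-; rewrite mulr0.
case/pX.2 => H.
  by move: fz1; rewrite E1 -subE H ?eqxx //; case: sx1.
by move: gz2; rewrite E2 -subE H ?eqxx //; case: sx2.
Qed.

End Conormal.

(** * Reflexivity at the generic point *)

Section Reflexivity.
Variables (F : closedFieldType) (n : nat).
Hypothesis ch0 : [pchar F] =i pred0.
Local Notation V := 'rV[F]_n.
Local Notation jac x f := (jacobian_at idfun (x ord0) f).
Local Notation diff f x := (differential idfun f (x ord0)).
Implicit Types (A X : set V) (x v xi : V) (z : 'rV[F]_(n + n)).

Definition on_space (f : {mpoly F[n]}) : {mpoly F[n + n]} :=
  mmap (@mpolyC (n + n) F) (fun i => 'X_(lshift n i)) f.
Definition on_dual (f : {mpoly F[n]}) : {mpoly F[n + n]} :=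
  mmap (@mpolyC (n + n) F) (fun i => 'X_(rshift n i)) f.

Section Evaluation.
Variables (K : fieldType) (iota : {rmorphism F -> K}) (theta w : 'rV[K]_(n + n)).

Lemma mmap_on_space f :
  mmap iota (theta ord0) (on_space f) = mmap iota (lsubmx theta ord0) f.
Proof. by rewrite -mmap_mmap; apply: eq_mmap => // i; rewrite mmapXU mxE. Qed.

Lemma mmap_on_dual f :
  mmap iota (theta ord0) (on_dual f) = mmap iota (rsubmx theta ord0) f.
Proof. by rewrite -mmap_mmap; apply: eq_mmap => // i; rewrite mmapXU mxE. Qed.

Lemma dpair_on_space f : dpair iota (on_space f) (theta ord0) (w ord0)
  = dpair iota f (lsubmx theta ord0) (lsubmx w ord0).
Proof.
rewrite dpair_comp; apply: eq_bigr => i _; rewrite dpairX mxE; congr (_ * _).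
by apply: eq_mmap => // j; rewrite mmapXU mxE.
Qed.

Lemma dpair_on_dual f : dpair iota (on_dual f) (theta ord0) (w ord0)
  = dpair iota f (rsubmx theta ord0) (rsubmx w ord0).
Proof.
rewrite dpair_comp; apply: eq_bigr => i _; rewrite dpairX mxE; congr (_ * _).
by apply: eq_mmap => // j; rewrite mmapXU mxE.
Qed.

End Evaluation.

Lemma vanishing_dual X f :
  vanishing_ideal (dual_variety X) f <-> vanishing_ideal (conormal_bundle X) (on_dual f).
Proof.
have E z : (on_dual f).@[z ord0] = f.@[rsubmx z ord0] by exact: (mmap_on_dual idfun).
rewrite -(vanishing_closure (conormal_bundle X)); split=> H.
  by move=> z Iz; rewrite E; apply: H; exists z.
by move=> _ [z Iz <-]; rewrite -E; exact: H.
Qed.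

Section AtGenericPoint.
Variables (X : set V).
Hypotheses (irrX : irreducible_closed (@zariski_closed F n) X) (coneX : is_cone X).
Hypothesis NX0 : conormal_bundle X !=set0.
Variables (K : fieldType) (iota : {rmorphism F -> K}) (theta : 'rV[K]_(n + n)).
Hypothesis gen : is_generic_point (conormal_bundle X) iota theta.

(** The conormal bundle maps onto the smooth locus, which is dense. *)
Lemma generic_base : is_generic_point X iota (lsubmx theta).
Proof.
have E f z : (on_space f).@[z ord0] = f.@[lsubmx z ord0] by exact: (mmap_on_space idfun).
move=> f; rewrite -mmap_on_space; split=> [/gen H|Xf].
  have [z Nz] := NX0; apply: (smooth_locus_dense ch0 irrX Nz.1) => x sx.
  have := H _ (conormal_mem sx (vanishing_ideal0 (X := X))).
  by rewrite E row_mxKl.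
by apply/gen => z [[Xz _] _]; rewrite E; exact: Xf.
Qed.

Lemma generic_dual : is_generic_point (dual_variety X) iota (rsubmx theta).
Proof. by move=> f; rewrite -mmap_on_dual vanishing_dual; exact: gen. Qed.

(** To lie in the span of the frame is a condition on the rank of a polynomial
    matrix, satisfied at the points of the bundle where the frame is
    independent. *)
Lemma generic_conormal x0 c (f : 'I_c -> {mpoly F[n]}) :
    smooth_locus X x0 -> conormal_frame X x0 f ->
  (rsubmx theta <= jacobian_at iota (lsubmx theta ord0) f)%MS.
Proof.
move=> sx0 Hf; have pX := irreducible_prime irrX; have [_ free0 _] := Hf.
apply: contrapT => nxi.
pose M : 'M[{mpoly F[n + n]}]_(c + 1, n) :=
  col_mx (map_mx on_space (jacobian f)) (\row_j 'X_(rshift n j)).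
have ME (L : fieldType) (kappa : {rmorphism F -> L}) (z : 'rV[L]_(n + n)) :
    map_mx (mmap kappa (z ord0)) M
    = col_mx (jacobian_at kappa (lsubmx z ord0) f) (rsubmx z).
  rewrite map_col_mx; congr col_mx; apply/matrixP => i j; rewrite !mxE.
    by rewrite mmap_on_space.
  by rewrite mmapXU (ord1 i).
have : row_free (map_mx (mmap iota (theta ord0)) M).
  rewrite ME; apply/row_free_col_mx; split=> //.
  by apply/(generic_row_free _ generic_base); exists x0 => //; case: sx0.
move=> /(generic_row_free _ gen)[z [sz nz]].
rewrite (ME F idfun) => /row_free_col_mx[freez]; apply.
apply: (@conormal_sub_frame F n X (lsubmx z)) => //.
by apply: (frame_persists ch0 pX sx0 Hf) => //; case: sz.
Qed.

(** A tangent vector of the dual variety lifts to the conormal variety; there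
    differentiate the incidence relation. The variation of the point does not
    contribute, because the covector is conormal. *)
Lemma generic_incidence w : generic_tangent iota (rsubmx theta ord0) w ->
  \sum_i lsubmx theta ord0 i * w i = 0.
Proof.
move=> Tw.
have [|t [Tt Et]] := @generic_tangent_lift F K iota (n + n) n (theta ord0)
    (fun j => 'X_(rshift n j)) w (pchar_ext ch0 iota).
  move=> f f0; rewrite -[RHS](Tw f) -?f0.
    apply: eq_bigr => i _; congr (_ * _); apply: eq_mmap => // j.
    by rewrite mmapXU mxE.
  by apply: eq_mmap => // j; rewrite mmapXU mxE.
pose inc : {mpoly F[n + n]} := \sum_i 'X_(lshift n i) * 'X_(rshift n i).
have Ninc : vanishing_ideal (conormal_bundle X) inc.
  move=> _ /conormal_memP[x [G [sx XG ->]]].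
  have := euler_relation coneX XG (proj1 sx) => E; rewrite -[RHS]E rmorph_sum /=.
  apply: eq_bigr => i _; rewrite mevalM !mevalXU row_mxEl row_mxEr mulrC.
  by rewrite mxE.
have := Tt inc ((gen _).2 Ninc).
have -> : dpair iota inc (theta ord0) t =
    \sum_i (theta ord0 (lshift n i) * t (rshift n i) + t (lshift n i) * theta ord0 (rshift n i)).
  rewrite /inc; elim: (index_enum _) => [|i s IH].
    by rewrite !big_nil -mpolyC0 dpairC.
  by rewrite !big_cons dpairD IH dpairM !dpairX !mmapXU.
rewrite big_split /=.
(* the component along the space is tangent to [X], so killed by the covector *)
have -> : \sum_i t (lshift n i) * theta ord0 (rshift n i) = 0.
  have [z Nz] := NX0; have sx := Nz.1.
  have [c [f Hf]] := exists_conormal_frame X (lsubmx z).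
  have /submxP[u Eu] := generic_conormal sx Hf; have [Xf _ _] := Hf.
  pose tl : 'rV[K]_n := \row_i t (lshift n i).
  have Jt : tl *m (jacobian_at iota (lsubmx theta ord0) f)^T = 0.
    apply/jacobian_mulmx => i.
    have /Tt : mmap iota (theta ord0) (on_space (f i)) = 0.
      by rewrite mmap_on_space; apply/generic_base.
    move=> E; rewrite -[RHS]E.
    transitivity (dpair iota (on_space (f i)) (theta ord0) ((\row_j t j) ord0)).
      by rewrite dpair_on_space; apply: eq_bigr => j _; rewrite !mxE.
    by congr dpair; apply/funext => j; rewrite mxE.
  have : (rsubmx theta *m tl^T) 0 0 = 0.
    rewrite Eu -mulmxA -[jacobian_at _ _ _]trmxK -trmx_mul Jt.
    by rewrite trmx0 mulmx0 mxE.
  move=> E; rewrite -[RHS]E mxE; apply: eq_bigr => i _; by rewrite !mxE mulrC.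
rewrite addr0 => E; rewrite -[RHS]E; apply: eq_bigr => i _; rewrite mxE; congr (_ * _).
by rewrite Et dpairX.
Qed.

(** The tangent space of the dual variety at its generic point is the kernel of
    the frame [h]: it is contained in it, and the smoothness of [xi0] makes it
    large enough. Hence the point, which annihilates this tangent space, lies in
    the span of the frame. *)
Lemma generic_reflexivity xi0 c (h : 'I_c -> {mpoly F[n]}) :
    smooth_locus (dual_variety X) xi0 -> conormal_frame (dual_variety X) xi0 h ->
  (lsubmx theta <= jacobian_at iota (rsubmx theta ord0) h)%MS.
Proof.
move=> sxi Hh; have [Wh free0 _] := Hh.
have /(smooth_frame Hh)[Wxi [chain _]] := sxi.
have [y indy] := chain_independent chain.
have [W Wfree HW] := generic_tangent_rows ch0 generic_dual indy.
set J := jacobian_at _ _ _.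
have Jfree : row_free J by apply/(generic_row_free _ generic_dual); exists xi0.
have WJ : (W <= kermx J^T)%MS by exact: tangent_rows_sub generic_dual Wh HW.
apply: orthogonal_sub => v /(kernel_sub_rows Wfree Jfree erefl WJ)/submxP[u ->].
rewrite trmx_mul mulmxA (_ : _ *m W^T = 0) ?mul0mx //.
apply/rowP => k; rewrite !mxE -[RHS](generic_incidence (HW k)); apply: eq_bigr => i _.
by rewrite !mxE.
Qed.

End AtGenericPoint.
End Reflexivity.

(** * The conormal variety is isotropic over smooth covectors *)

Lemma cramer_row (K : fieldType) c n (J : 'M[K]_(c, n)) (g : 'I_c -> 'I_n) (x : 'rV[K]_n) :
  (x <= J)%MS -> \det (colsub g J) *: x = colsub g x *m \adj (colsub g J) *m J.
Proof.
move=> /submxP[u ->].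
by rewrite -mulmx_colsub -[u *m _ *m _]mulmxA mul_mx_adj mul_mx_scalar -scalemxAl.
Qed.

Section Isotropy.
Variables (F : closedFieldType) (n : nat).
Hypothesis ch0 : [pchar F] =i pred0.
Local Notation V := 'rV[F]_n.
Local Notation jac x f := (jacobian_at idfun (x ord0) f).
Implicit Types (X : set V) (z w : 'rV[F]_(n + n)).

Lemma zariski_closure_nonempty m (A : set 'rV[F]_m) x : zariski_closure A x -> A !=set0.
Proof.
move=> Ax; apply/set0P/eqP => A0; move: Ax; rewrite zariski_closure_locus A0.
have I1 : vanishing_ideal (set0 : set 'rV[F]_m) 1 by move=> y [].
by move=> /(_ _ I1)/eqP; rewrite meval1 oner_eq0.
Qed.

Section Equations.
Variables (c : nat) (h : 'I_c -> {mpoly F[n]}) (g : 'I_c -> 'I_n).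

Let Jp : 'M[{mpoly F[n + n]}]_(c, n) := map_mx (@on_dual F n) (jacobian h).
Let Xp : 'rV[{mpoly F[n + n]}]_n := \row_j 'X_(lshift n j).
Let delta : {mpoly F[n + n]} := \det (colsub g Jp).
Let lambda : 'rV[{mpoly F[n + n]}]_c := colsub g Xp *m \adj (colsub g Jp).

(** Cramer's equations for the point of the space to lie in the span of the
    differentials of [h] at the covector. These are polynomials, so they can be
    differentiated at points where the conormal variety is not known to be
    smooth. *)
Definition span_equation (k : 'I_n) : {mpoly F[n + n]} :=
  delta * 'X_(lshift n k) - \sum_i lambda 0 i * on_dual (h i)^`M(k).

Lemma map_Jp (K : fieldType) (kappa : {rmorphism F -> K}) (t : 'rV[K]_(n + n)) :
  map_mx (mmap kappa (t ord0)) Jp = jacobian_at kappa (rsubmx t ord0) h.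
Proof. by apply/matrixP => i j; rewrite !mxE mmap_on_dual. Qed.

Lemma mmap_delta (K : fieldType) (kappa : {rmorphism F -> K}) (t : 'rV[K]_(n + n)) :
  mmap kappa (t ord0) delta = \det (colsub g (jacobian_at kappa (rsubmx t ord0) h)).
Proof. by rewrite det_colsub_mmap map_Jp. Qed.

Lemma map_lambda (K : fieldType) (kappa : {rmorphism F -> K}) (t : 'rV[K]_(n + n)) :
  map_mx (mmap kappa (t ord0)) lambda =
  colsub g (lsubmx t) *m \adj (colsub g (jacobian_at kappa (rsubmx t ord0) h)).
Proof.
rewrite map_mxM map_mx_adj -(map_Jp kappa t); congr (_ *m \adj _).
  by apply/matrixP => i j; rewrite !mxE /= mmapXU (ord1 i).
by apply/matrixP => i j; rewrite !mxE.
Qed.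

Lemma mmap_span_equation (K : fieldType) (kappa : {rmorphism F -> K}) (t : 'rV[K]_(n + n)) k :
    (lsubmx t <= jacobian_at kappa (rsubmx t ord0) h)%MS ->
  mmap kappa (t ord0) (span_equation k) = 0.
Proof.
move=> /(cramer_row g)/matrixP/(_ 0 k); rewrite -map_lambda -mmap_delta => E.
rewrite /span_equation rmorphB rmorphM /= mmapXU; apply/eqP; rewrite subr_eq0; apply/eqP.
rewrite !mxE in E; apply: etrans E _; rewrite rmorph_sum /=.
by apply: eq_bigr => i _; rewrite rmorphM /= !mxE mmap_on_dual.
Qed.

(** The Hessians of the [h i] combined with the coefficients [lambda] of the
    point on their differentials. *)
Definition lambda_hessian z (b b' : V) : F :=
  \sum_i (lambda 0 i).@[z ord0] *
    \sum_k dpair idfun (h i)^`M(k) (rsubmx z ord0) (b ord0) * b' ord0 k.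

Lemma lambda_hessian_sym z b b' : lambda_hessian z b b' = lambda_hessian z b' b.
Proof.
apply: eq_bigr => i _; congr (_ * _); rewrite /dpair.
under eq_bigr do rewrite mulr_suml.
rewrite exchange_big /=; apply: eq_bigr => k _; rewrite mulr_suml.
by apply: eq_bigr => l _; rewrite mderiv_comm mulrAC.
Qed.

(** Differentiate the equations along [w] and pair with [b']: all terms containing
    the differentials of the [h i] themselves disappear, since these kill [b']. *)
Lemma span_equation_tangent z w (b' : V) :
    (forall k, (span_equation k).@[z ord0] = 0) ->
    (forall k, dpair idfun (span_equation k) (z ord0) (w ord0) = 0) ->
    delta.@[z ord0] != 0 ->
    b' *m (jac (rsubmx z) h)^T = 0 ->
  delta.@[z ord0] * \sum_k lsubmx w ord0 k * b' ord0 k = lambda_hessian z (rsubmx w) b'.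
Proof.
move=> Ez Ew d0 /jacobian_mulmx Jb'.
(* by the equations themselves, the point lies in the span of the [dh_i] *)
have yb' : \sum_k lsubmx z ord0 k * b' ord0 k = 0.
  apply: (mulfI d0); rewrite mulr0 mulr_sumr.
  have E k : delta.@[z ord0] * (lsubmx z ord0 k * b' ord0 k) =
      \sum_i (lambda 0 i).@[z ord0] * ((h i)^`M(k).@[rsubmx z ord0] * b' ord0 k).
    have /eqP := Ez k; rewrite /span_equation mevalB mevalM mevalXU subr_eq0 => /eqP E.
    rewrite mulrA mxE E rmorph_sum /= mulr_suml; apply: eq_bigr => i _.
    by rewrite mevalM -mulrA; congr (_ * (_ * _)); exact: (mmap_on_dual idfun).
  under eq_bigr do rewrite E.
  rewrite exchange_big big1 //= => i _; rewrite -mulr_sumr.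
  by rewrite [X in _ * X](Jb' i) mulr0.
have E k : delta.@[z ord0] * (lsubmx w ord0 k * b' ord0 k) =
    \sum_i ((lambda 0 i).@[z ord0] *
      (dpair idfun (h i)^`M(k) (rsubmx z ord0) (rsubmx w ord0) * b' ord0 k)
      + dpair idfun (lambda 0 i) (z ord0) (w ord0)
      * ((h i)^`M(k).@[rsubmx z ord0] * b' ord0 k))
    - dpair idfun delta (z ord0) (w ord0) * (lsubmx z ord0 k * b' ord0 k).
  have := Ew k; rewrite /span_equation dpairB dpairM dpairX mmapXU => /eqP.
  rewrite subr_eq0 => /eqP Ek; apply/eqP; rewrite eq_sym subr_eq eq_sym; apply/eqP.
  rewrite !mulrA -mulrDl [lsubmx w _ _]mxE [lsubmx z _ _]mxE Ek.
  rewrite (_ : dpair _ (\sum_i _) _ _ = \sum_i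
     ((lambda 0 i).@[z ord0] * dpair idfun (h i)^`M(k) (rsubmx z ord0) (rsubmx w ord0)
     + dpair idfun (lambda 0 i) (z ord0) (w ord0) * (h i)^`M(k).@[rsubmx z ord0])).
    by rewrite mulr_suml; apply: eq_bigr => i _; rewrite mulrDl !mulrA.
  elim: (index_enum _) => [|i s IH]; first by rewrite !big_nil -mpolyC0 dpairC.
  by rewrite !big_cons dpairD IH dpairM dpair_on_dual (mmap_on_dual idfun).
rewrite mulr_sumr; under eq_bigr do rewrite E.
rewrite sumrB -mulr_sumr yb' mulr0 subr0 exchange_big /=.
apply: eq_bigr => i _; rewrite big_split /= -!mulr_sumr.
by rewrite [X in _ + _ * X](Jb' i) mulr0 addr0.
Qed.

End Equations.

(** Over a smooth point of the dual variety, the conormal variety satisfies the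
    equations of the conormal bundle of the dual variety. These express the
    pairing of two tangent vectors through a combination of Hessians, which is
    symmetric. *)
Lemma conormal_isotropic X z w w' :
    irreducible_closed (@zariski_closed F n) X -> is_cone X ->
    conormal_variety X z -> smooth_locus (dual_variety X) (rsubmx z) ->
    variety_tangent_space (conormal_variety X) z w ->
    variety_tangent_space (conormal_variety X) z w' ->
  \sum_k lsubmx w ord0 k * rsubmx w' ord0 k = \sum_k lsubmx w' ord0 k * rsubmx w ord0 k.
Proof.
move=> irrX coneX Iz sxi.
rewrite /variety_tangent_space /conormal_variety vanishing_closure => Tw Tw'.
have NX0 := zariski_closure_nonempty Iz.
have pN := conormal_prime ch0 irrX NX0.
have [K [iota [theta [gen _]]]] := exists_generic_point pN.
have [c [h Hh]] := exists_conormal_frame (dual_variety X) (rsubmx z).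
have [Wh free _] := Hh; have [g Hg] := row_free_colsub free.
have NE k : vanishing_ideal (conormal_bundle X) (span_equation h g k).
  by apply/gen/mmap_span_equation; apply: generic_reflexivity sxi Hh.
have Ez k : (span_equation h g k).@[z ord0] = 0.
  by move: Iz; rewrite /conormal_variety zariski_closure_locus; apply.
have Jt (t : 'rV[F]_(n + n)) : tangent_space (vanishing_ideal (conormal_bundle X)) z t ->
    rsubmx t *m (jac (rsubmx z) h)^T = 0.
  move=> Tt; apply/jacobian_mulmx => i; have := Tt _ ((vanishing_dual X (h i)).1 (Wh i)).
  by move=> E; rewrite -[RHS]E; rewrite -[RHS]/(dpair idfun (on_dual (h i)) (z ord0) (t ord0)) dpair_on_dual.
have d0 : (\det (colsub g (map_mx (@on_dual F n) (jacobian h)))).@[z ord0] != 0.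
  by rewrite /meval (mmap_delta h g idfun).
apply: (mulfI d0).
rewrite (span_equation_tangent Ez (fun k => Tw _ (NE k)) d0 (Jt _ Tw')).
by rewrite (span_equation_tangent Ez (fun k => Tw' _ (NE k)) d0 (Jt _ Tw)) lambda_hessian_sym.
Qed.

End Isotropy.

(** * Dominant maps are generically submersive *)

Section Submersion.
Variables (F : closedFieldType) (n : nat).
Hypothesis ch0 : [pchar F] =i pred0.
Local Notation V := 'rV[F]_n.
Local Notation jac x f := (jacobian_at idfun (x ord0) f).
Local Notation diff f x := (differential idfun f (x ord0)).
Implicit Types (Y : set V) (E : set 'rV[F]_(n + n)) (z w : 'rV[F]_(n + n)).

Lemma clear_denominators (K : fieldType) (iota : {rmorphism F -> K}) m (theta : 'I_m -> K)
    (I : finType) (k : I -> K) :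
    (forall x : K, exists f g, mmap iota theta g != 0 /\
      x = mmap iota theta f / mmap iota theta g) ->
  exists (s : K) (p : I -> {mpoly F[m]}), s != 0 /\ forall i, mmap iota theta (p i) = s * k i.
Proof.
move=> frac; have [a Ha] := choice (fun i => frac (k i)).
have [b Hb] := choice Ha.
exists (\prod_i mmap iota theta (b i)), (fun i => a i * \prod_(j | j != i) b j).
split; first by apply/prodf_neq0 => i _; case: (Hb i).
move=> i; rewrite rmorphM rmorph_prod /= [in RHS](bigD1 i) //=.
have [bi0 ->] := Hb i.
by rewrite [RHS]mulrAC [X in _ = X * _]mulrC divfK.
Qed.

(** If [E] is irreducible and dominates [Y], a basis of the tangent space at the
    generic point of [Y] lifts to the generic point of [E], and after clearing
    denominators to polynomial vector fields tangent to [E] everywhere. Their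
    projections span the tangent space of [Y] outside a smaller closed subset of
    [E] and a hypersurface of [Y]; the smaller subset is treated by noetherian
    induction. In this way no fibre has to be assumed smooth, and the exceptional
    set depends on the point of [Y] only. *)
Lemma generic_submersion Y E : irreducible_closed (@zariski_closed F n) Y ->
    zariski_closed E -> (forall z, E z -> Y (lsubmx z)) ->
  exists2 G : {mpoly F[n]}, ~ vanishing_ideal Y G &
    forall z v, E z -> G.@[lsubmx z ord0] != 0 -> variety_tangent_space Y (lsubmx z) v ->
      exists2 w, variety_tangent_space E z w & lsubmx w = v.
Proof.
move=> irrY; have pY := irreducible_prime irrY; move: E.
apply: zariski_closed_ind => E cE IH EY.
have subT E' z w : E' `<=` E -> variety_tangent_space E' z w -> variety_tangent_space E z w.
  by move=> EE' Tw f /(vanishing_idealS EE')/Tw.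
have [E0|irrE|[B [C [cB cC ltB ltC EBC]]]] := zariski_trichotomy cE.
- exists 1; first by have [y Yy] := pY.1; move=> /(_ y Yy)/eqP; rewrite meval1 oner_eq0.
  by move=> z v; rewrite E0.
- have pE := irreducible_prime irrE.
  have [[f [nYf Ef]]|dom] := pselect (exists f, ~ vanishing_ideal Y f /\
      vanishing_ideal E (on_space f)).
    exists f => // z v /Ef; rewrite -[_.@[_]]/(mmap idfun _ _) mmap_on_space /meval => ->.
    by rewrite eqxx.
  have [K [iota [theta [gen frac]]]] := exists_generic_point pE.
  have onE f : vanishing_ideal Y f -> vanishing_ideal E (on_space f).
    move=> Yf z Ez; rewrite -[LHS]/(mmap idfun _ _) mmap_on_space.
    exact: (Yf _ (EY _ Ez)).
  (* [E] dominates [Y]: the projection of its generic point is generic in [Y] *)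
  have genY : is_generic_point Y iota (lsubmx theta).
    move=> f; rewrite -mmap_on_space; split=> [/gen H|/onE/gen//].
    by apply: contrapT => nf; apply: dom; exists f.
  have [c [f [Yf ffree maxf]]] := maximal_jacobian iota (lsubmx theta ord0) (vanishing_ideal Y).
  set J := jacobian_at iota _ f in ffree maxf.
  pose d := \rank (kermx J^T); pose W : 'M[K]_(d, n) := row_base (kermx J^T).
  have Wfree : row_free W by exact: row_base_free.
  have Ed : (d = n - c)%N by rewrite /d mxrank_ker mxrank_tr; move/eqP: ffree => ->.
  have WJ : W *m J^T = 0 by apply/sub_kermxP; rewrite eq_row_base.
  have TW k : generic_tangent iota (lsubmx theta ord0) (row k W ord0).
    move=> g /genY/maxf/submxP[u Eu]; rewrite dpair_mulmx Eu -mulmxA.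
    by rewrite -[J]trmxK -trmx_mul -row_mul WJ row0 trmx0 mulmx0 mxE.
  have lift k : exists t, generic_tangent iota (theta ord0) t /\
      forall j, row k W ord0 j = t (lshift n j).
    have [|t [Tt Et]] := @generic_tangent_lift F K iota (n + n) n (theta ord0)
      (fun j => 'X_(lshift n j)) (row k W ord0) (pchar_ext ch0 iota).
      move=> g g0; rewrite -[RHS](TW k g) -?g0.
        apply: eq_bigr => i _; congr (_ * _); apply: eq_mmap => // j.
        by rewrite mmapXU [RHS]mxE.
      by apply: eq_mmap => // j; rewrite mmapXU [LHS]mxE.
    by exists t; split=> // j; rewrite Et dpairX.
  have [t Ht] := choice lift.
  have [s [p [s0 Hp]]] :=
    clear_denominators (fun ki : 'I_d * 'I_(n + n) => t ki.1 ki.2) frac.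
  pose P : 'M[{mpoly F[n + n]}]_(d, n + n) := \matrix_(k, i) p (k, i).
  (* the rows of [P] are polynomial vector fields tangent to [E] *)
  have TP z g : E z -> vanishing_ideal E g -> diff g z *m (map_mx (meval (z ord0)) P)^T = 0.
    move=> Ez Eg; apply/rowP => k; rewrite !mxE.
    have : vanishing_ideal E (\sum_i g^`M(i) * p (k, i)).
      apply/gen; rewrite rmorph_sum /=.
      transitivity (s * dpair iota g (theta ord0) (t k)); last first.
        by rewrite ((Ht k).1 g ((gen g).2 Eg)) mulr0.
      rewrite mulr_sumr.
      by apply: eq_bigr => i _; rewrite rmorphM /= Hp mulrCA.
    move/(_ z Ez); rewrite rmorph_sum /= => E0; rewrite -[RHS]E0.
    by apply: eq_bigr => i _; rewrite !mxE mevalM.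
  pose Pl := lsubmx P.
  have Plfree : row_free (map_mx (mmap iota (theta ord0)) Pl).
    have -> : map_mx (mmap iota (theta ord0)) Pl = s *: W.
      by apply/matrixP => k j; rewrite !mxE Hp /= -(Ht k).2 !mxE.
    by rewrite /row_free (eqmx_scale _ s0); exact: Wfree.
  have [g1 Hg1] := row_free_colsub Plfree; rewrite -det_colsub_mmap in Hg1.
  set d1 := \det _ in Hg1.
  have [g2 Hg2] := row_free_colsub ffree; rewrite -det_colsub_mmap in Hg2.
  set d2 := \det _ in Hg2.
  have nd2 : ~ vanishing_ideal Y d2 by move=> /genY/eqP; rewrite (negPf Hg2).
  (* where the projected fields become dependent, induction applies *)
  pose E1 := E `&` [set z | d1.@[z ord0] = 0].
  have cE1 : zariski_closed E1 by apply: zariski_closedI => //; exact: closed_zero.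
  have ltE1 : E1 `<` E.
    split; first exact: subIsetl.
    by move=> H; move/eqP: Hg1; apply; apply/gen => z /H[].
  have [|G nG HG] := IH _ cE1 ltE1; first by move=> z [/EY].
  exists (G * d2); first by move=> /pY.2[].
  move=> z v Ez; rewrite mevalM mulf_eq0 negb_or => /andP[Gz d2z] Tv.
  have [d1z|d1z] := eqVneq (d1.@[z ord0]) 0.
    have [w Tw lw] := HG z v (conj Ez d1z) Gz Tv.
    by exists w => //; apply: subT Tw; exact: subIsetl.
  have Plz : row_free (map_mx (meval (z ord0)) Pl).
    by apply: (colsub_row_free (g := g1)); rewrite -(det_colsub_mmap idfun).
  have Jz : row_free (jac (lsubmx z) f).
    by apply: (colsub_row_free (g := g2)); rewrite -(det_colsub_mmap idfun).
  have PJ : (map_mx (meval (z ord0)) Pl <= kermx (jac (lsubmx z) f)^T)%MS.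
    apply/row_subP => k; apply/sub_kermxP/jacobian_mulmx => i.
    pose Pz := map_mx (meval (z ord0)) P.
    have E0 : (diff (on_space (f i)) z *m (row k Pz)^T) 0 0 = 0.
      transitivity ((diff (on_space (f i)) z *m Pz^T) 0 k).
        by rewrite !mxE; apply: eq_bigr => j _; rewrite !mxE.
      by rewrite TP ?mxE //; exact: onE.
    have <- : lsubmx (row k Pz) = row k (map_mx (meval (z ord0)) Pl).
      by apply/rowP => j; rewrite !mxE.
    by rewrite -(dpair_on_space idfun) dpair_mulmx.
  have Jv : v *m (jac (lsubmx z) f)^T = 0 by apply/jacobian_mulmx => i; exact: (Tv _ (Yf i)).
  have /submxP[u Eu] := kernel_sub_rows Plz Jz Ed PJ Jv.
  exists (u *m map_mx (meval (z ord0)) P).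
    move=> g Eg; rewrite -[LHS]/(dpair idfun g (z ord0) _) dpair_mulmx trmx_mul mulmxA.
    by rewrite TP // mul0mx mxE.
  by rewrite Eu -mulmx_lsub; congr (_ *m _); apply/matrixP => k j; rewrite !mxE.
- have [|G1 nG1 HG1] := IH _ cB ltB; first by move=> z /ltB.1/EY.
  have [|G2 nG2 HG2] := IH _ cC ltC; first by move=> z /ltC.1/EY.
  exists (G1 * G2); first by move=> /pY.2[].
  move=> z v; rewrite {1}EBC mevalM mulf_eq0 negb_or => Ez /andP[G1z G2z] Tv.
  case: Ez => Hz.
    by have [w Tw lw] := HG1 z v Hz G1z Tv; exists w => //; apply: subT Tw; exact: ltB.1.
  by have [w Tw lw] := HG2 z v Hz G2z Tv; exists w => //; apply: subT Tw; exact: ltC.1.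
Qed.

End Submersion.

(** * Affine cones over projective varieties *)

Section Cones.
Variables (F : closedFieldType) (N : nat).
Local Notation V := 'rV[F]_N.+1.
Implicit Types (P : set (proj_space F N)) (x : V) (L : proj_space F N) (f : {mpoly F[N.+1]}).

Lemma meval_scale_dhomog d f t x : f \is d.-homog -> f.@[(t *: x) ord0] = t ^+ d * f.@[x ord0].
Proof.
move=> homf; rewrite !mevalE mulr_sumr; apply: eq_big_seq => m /(dhomog_mf homf) <-.
rewrite mulrCA; congr (_ * _); rewrite /= mdegE -prodrXr -big_split /=.
by apply: eq_bigr => i _; rewrite mxE exprMn.
Qed.

Definition restrict_line f x : {poly F} := \poly_(d < msize f) (pihomog mdeg d f).@[x ord0].

Lemma restrict_lineE f x t : (restrict_line f x).[t] = f.@[(t *: x) ord0].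
Proof.
rewrite horner_poly [in RHS](pihomog_partitionE (leqnn (msize f))) rmorph_sum /=.
by apply: eq_bigr => d _; rewrite (meval_scale_dhomog _ _ (pihomogP _ _ _)) mulrC.
Qed.

Lemma exists_line x : x != 0 -> exists L, sval L = <[x]>%VS.
Proof.
move=> x0; have H : \dim <[x]>%VS == 1%N by rewrite dim_vline x0.
by exists (exist _ <[x]>%VS H).
Qed.

Lemma line_generator L : exists2 x, x != 0 & sval L = <[x]>%VS.
Proof.
case: L => L /= dL; have L0 : L != 0%VS.
  by apply/eqP => E; move: (dL); rewrite E dimv0.
exists (vpick L); first by rewrite vpick0.
apply/esym/eqP; rewrite eqEdim -memvE memv_pick dim_vline vpick0 L0.
by move/eqP: dL => ->.
Qed.

Lemma affine_cone_is_cone P : is_cone (affine_cone P).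
Proof.
move=> t x [->|[L PL Lx]]; first by rewrite scaler0; left.
by right; exists L => //; exact: memvZ.
Qed.

Lemma affine_cone_closed P : proj_closed P -> P !=set0 -> zariski_closed (affine_cone P).
Proof.
move=> [S homS EP] [L0 PL0]; exists S; apply/seteqP; split=> x.
  move=> [->|[L PL Lx]] f Sf; first by move: PL0; rewrite EP; apply=> //; exact: mem0v.
  by move: PL; rewrite EP; apply.
move=> Sx; have [->|x0] := eqVneq x 0; first by left.
have [L EL] := exists_line x0; right; exists L; last by rewrite EL memv_line.
rewrite EP => f Sf y; rewrite EL => /vlineP[k ->]; have [d homf] := homS f Sf.
by rewrite (meval_scale_dhomog _ _ homf) (Sx f Sf) mulr0.
Qed.

Definition lines_in (B : set V) : set (proj_space F N) :=
  [set L : proj_space F N | forall x, x \in sval L -> B x].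

(** A polynomial vanishes along a line through the origin iff its homogeneous
    components vanish on it. *)
Lemma lines_in_closed (B : set V) : zariski_closed B ->
  proj_closed (lines_in B).
Proof.
move=> [S ->]; exists [set g | exists f d, S f /\ g = pihomog mdeg d f].
  by move=> _ [f [d [_ ->]]]; exists d; exact: pihomogP.
apply/seteqP; split=> L /= H.
  move=> _ [f [d [Sf ->]]] x Lx.
  have E : restrict_line f x = 0.
    apply/eqP/negPn/negP => /exists_nonroot[t]; rewrite restrict_lineE => /eqP; apply.
    by apply: H Sf; exact: memvZ.
  have [ltd|led] := ltnP d (msize f).
    by have := coef_poly (msize f) (fun d => (pihomog mdeg d f).@[x ord0]) d;
      rewrite -/(restrict_line f x) E coef0 ltd.
  rewrite (_ : pihomog _ _ _ = 0) ?meval0 //.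
  rewrite pihomogE big1_seq // => m /andP[/eqP Em mf]; move: led.
  by rewrite leqNgt -Em msize_mdeg_lt.
move=> x Lx f Sf; rewrite -[x]scale1r -restrict_lineE.
rewrite horner_poly big1 // => d _; rewrite (H (pihomog mdeg d f)) ?mul0r //.
by exists f, d.
Qed.

(** If two closed sets cover the cone, every line of the cone is contained in one
    of them, being irreducible; the lines contained in either set form a
    projective closed set. *)
Lemma affine_cone_irreducible P : proj_variety P ->
  irreducible_closed (@zariski_closed F N.+1) (affine_cone P).
Proof.
move=> [cP P0 irrP]; split; [exact: affine_cone_closed|by exists 0; left|].
move=> B D cB cD CBD.
have sub (A : set V) : P `<=` lines_in A -> affine_cone P `<=` A.
  move=> PA x [->|[L PL Lx]]; last exact: PA Lx.
  by have [L PL] := P0; apply: (PA L) => //; exact: mem0v.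
suff [/sub|/sub] : P `<=` lines_in B \/
    P `<=` lines_in D by [left|right].
apply: irrP; [exact: lines_in_closed|exact: lines_in_closed|].
move=> L PL; apply: contrapT => /not_orP[nB nD].
have [x x0 EL] := line_generator L.
have bad (A : set V) : zariski_closed A -> ~ (forall y, y \in sval L -> A y) ->
    exists f, vanishing_ideal A f /\ restrict_line f x != 0.
  move=> /zariski_closedP EA nA; apply: contrapT => H; apply: nA => y.
  rewrite EL => /vlineP[k ->]; rewrite EA => f Af; rewrite -restrict_lineE.
  have [->|ne] := eqVneq (restrict_line f x) 0; first by rewrite horner0.
  by case: H; exists f.
have [f [Bf fx]] := bad B cB nB; have [g [Dg gx]] := bad D cD nD.
have : restrict_line f x * restrict_line g x != 0 by rewrite mulf_neq0.
case/exists_nonroot => t; rewrite hornerM !restrict_lineE.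
have : affine_cone P (t *: x).
  by right; exists L => //; rewrite EL; apply: memvZ; exact: memv_line.
by move=> /CBD[/Bf|/Dg] ->; rewrite ?mul0r ?mulr0 eqxx.
Qed.

End Cones.

(** * Fibres of the conormal variety *)

Section Fibres.
Variables (F : closedFieldType) (n : nat).
Hypothesis ch0 : [pchar F] =i pred0.
Local Notation V := 'rV[F]_n.
Implicit Types (X Y : set V) (y v xi eta : V) (z : 'rV[F]_(n + n)).

Definition slice y (f : {mpoly F[n + n]}) : {mpoly F[n]} :=
  mmap (@mpolyC n F) (joint (fun i => (y ord0 i)%:MP) (fun i => 'X_i)) f.

(** Substituting the coordinates of [y] changes [f] by an element of the ideal
    generated by the [X_i - y_i]. *)
Lemma slice_dual_fibre X y f : vanishing_ideal (conormal_variety X) f ->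
  dual_fibre_ideal X y (slice y f).
Proof.
move=> If J [J0 JD JM] genJ.
have JN g : J g -> J (- g) by rewrite -mulN1r; exact: JM.
set sub := comp_mpoly _.
have subE g : sub (slice y g) = mmap (@mpolyC (n + n) F)
    (joint (fun i => (y ord0 i)%:MP) (fun i => 'X_(rshift n i))) g.
  rewrite /sub /slice /comp_mpoly -mmap_mmap; apply: eq_mmap => // i.
  rewrite /joint; case: (split i) => j; first by rewrite mmapC.
  by rewrite mmapXU tnth_mktuple.
suff H g : J (g - sub (slice y g)).
  rewrite -[sub _](subKr f); apply: JD; last by apply: JN; exact: H.
  by apply: genJ; left.
rewrite subE; elim/mpoly_generators_ind: g => [c|i|p q Jp Jq|p q Jp Jq].
- by rewrite mmapC subrr.
- rewrite mmapXU; case: (splitP i) => j Ej.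
    have -> : i = lshift n j by exact: val_inj.
    by rewrite joint_lshift; apply: genJ; right; exists j.
  have -> : i = rshift n j by exact: val_inj.
  by rewrite joint_rshift subrr.
- by rewrite rmorphD /= opprD addrACA; exact: JD.
- rewrite rmorphM /=; set p' := mmap _ _ p in Jp *; set q' := mmap _ _ q in Jq *.
  have -> : p * q - p' * q' = q * (p - p') + p' * (q - q') by ring.
  by apply: JD; exact: JM.
Qed.

Lemma meval_slice y xi f : (slice y f).@[xi ord0] = f.@[row_mx y xi ord0].
Proof.
rewrite mmap_polyC_eval; apply: meval_eq => i; rewrite row_mx_joint /joint.
by case: (split i) => j; rewrite ?mevalC ?mevalXU.
Qed.

Lemma dpair_slice y xi eta f :
  dpair idfun (slice y f) (xi ord0) (eta ord0) =
  dpair idfun f (row_mx y xi ord0) (row_mx 0 eta ord0).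
Proof.
rewrite dpair_comp; apply: eq_bigr => i _; congr (_ * _).
  apply: eq_mmap => // j; rewrite row_mx_joint /joint.
  by case: (split j) => k; rewrite ?mmapC ?mmapXU.
rewrite row_mx_joint /joint; case: (split i) => k; rewrite ?dpairC ?dpairX //.
by rewrite mxE.
Qed.

Lemma fibre_mem X y xi : zero_locus (dual_fibre_ideal X y) xi ->
  conormal_variety X (row_mx y xi).
Proof.
move=> Hxi; rewrite /conormal_variety zariski_closure_locus -vanishing_closure => f If.
by rewrite -meval_slice; apply: Hxi; exact: slice_dual_fibre.
Qed.

Lemma fibre_tangent X y xi eta : tangent_space (dual_fibre_ideal X y) xi eta ->
  variety_tangent_space (conormal_variety X) (row_mx y xi) (row_mx 0 eta).
Proof.
move=> Heta f If; rewrite -[LHS]/(dpair idfun f _ _) -dpair_slice.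
by apply: Heta; exact: slice_dual_fibre.
Qed.

Lemma closed_over Y : zariski_closed Y ->
  zariski_closed [set z : 'rV[F]_(n + n) | Y (lsubmx z)].
Proof.
move=> /zariski_closedP EY; exists [set on_space f | f in vanishing_ideal Y].
apply/seteqP; split=> z /=.
  move=> Yz _ [f Yf <-]; rewrite -[LHS]/(mmap idfun _ _) mmap_on_space; exact: Yf.
move=> Hz; rewrite EY => f Yf; rewrite -[LHS]/(mmap idfun _ _) -mmap_on_space.
by apply: Hz; exists f.
Qed.

(** Annihilating [v] is a closed and linear condition. *)
Lemma annihilator_span (v : V) (S : set V) :
    (forall s, S s -> pairing s v = 0) ->
  forall s, linear_span (zariski_closure S) s -> pairing s v = 0.
Proof.
move=> HS s Hs; have [T HT] := exists_kernel v.
have TE u : (u \in T) <-> pairing u v = 0.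
  rewrite HT pairingE; split=> [/eqP -> |E]; first by rewrite mxE.
  by apply/eqP/matrixP => i j; rewrite !ord1 E mxE.
apply/TE/Hs => u Hu; apply/TE.
pose lin : {mpoly F[n]} := \sum_i v ord0 i *: 'X_i.
have linE (t : V) : lin.@[t ord0] = pairing t v.
  by rewrite rmorph_sum; apply: eq_bigr => i _; rewrite /= mevalZ mevalXU mulrC.
rewrite -linE; apply: (Hu _ (closed_zero lin)) => t /HS.
by rewrite -linE.
Qed.

(** A tangent vector [s] of the fibre is a vertical tangent vector [(0, s)] of the
    conormal variety, and for general [y] every tangent vector [v] of [Y] lifts to
    a tangent vector [(v, u)]. By isotropy their symplectic product, which is the
    pairing of [s] and [v], vanishes. *)
Lemma tangent_span_annihilator X Y :
    irreducible_closed (@zariski_closed F n) X -> is_cone X ->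
    irreducible_closed (@zariski_closed F n) Y ->
  generically Y (fun y => tangent_span (dual_fibre_ideal X y) (dual_variety X)
    `<=` annihilator (variety_tangent_space Y y)).
Proof.
move=> irrX coneX irrY.
pose E := conormal_variety X `&` [set z : 'rV[F]_(n + n) | Y (lsubmx z)].
have cE : zariski_closed E.
  apply: zariski_closedI; last by apply: closed_over; case: irrY.
  by rewrite /conormal_variety zariski_closure_locus; exists (vanishing_ideal (conormal_bundle X)).
have [|G nG HG] := generic_submersion ch0 irrY cE; first by move=> z [].
exists [set y | G.@[y ord0] <> 0]; split.
- have EU : ~` [set y : V | G.@[y ord0] <> 0] = [set y | G.@[y ord0] = 0].
    by apply/seteqP; split=> y /= => [/contrapT|Gy0]; last exact.
  by rewrite /zariski_open EU; exact: closed_zero.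
- by move/existsNP: nG => [y /not_implyP[Yy Gy]]; exists y.
move=> y Yy Gy eta Heta v Tv; apply: annihilator_span Heta => s [xi [fibxi smxi] Ts].
have Iz := fibre_mem fibxi.
have Ez : E (row_mx y xi) by split=> //=; rewrite row_mxKl.
have [||w Tw lw] := HG (row_mx y xi) v Ez; rewrite ?row_mxKl //; first exact/eqP.
have Tw' : variety_tangent_space (conormal_variety X) (row_mx y xi) w.
  by move=> f If; apply: Tw => z [Iz' _]; exact: If.
have := conormal_isotropic ch0 irrX coneX Iz _ Tw' (fibre_tangent Ts).
rewrite row_mxKr lw => /(_ smxi); rewrite row_mxKr row_mxKl => E0.
rewrite /pairing; transitivity (\sum_k v ord0 k * s ord0 k).
  by apply: eq_bigr => i _; rewrite mulrC.
by rewrite E0 big1 // => i _; rewrite mxE mul0r.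
Qed.

End Fibres.

Theorem theorem2p2p4 (R : realType) (N : nat)
    (PX PY : set (proj_space R[i] N))
    (hX : proj_variety PX) (hY : proj_variety PY) (hYX : PY `<=` PX) :
  let X := affine_cone PX in
  let Y := affine_cone PY in
  generically Y (fun y =>
    tangent_span (dual_fibre_ideal X y) (dual_variety X)
      `<=` annihilator (variety_tangent_space Y y)).
Proof.
apply: tangent_span_annihilator.
- exact: Num.Theory.pchar_num.
- exact: affine_cone_irreducible.
- exact: affine_cone_is_cone.
- exact: affine_cone_irreducible.
Qed.
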